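(* Let $\mathcal R=[R_1',R_1]\times[R_2',R_2]\subset(0,\infty)^2$ be a fixed rectangle. For $X>0$ let $N(\mathcal R;X)$ denote the number of triples $(f,g,h)\in\mathbb{Z}[i]^3$ that are strongly carefree, satisfy $H(f,g,h)=|f|\,|g|^2\,|h|^3\le X$, and whose shape parameters $(\lambda_1,\lambda_2)=(|f|/|h|,\,|g|)$ lie in $\mathcal R$. Then \[ \lim_{X\to\infty}\frac{N(\mathcal R;X)}{X}=\int_{\mathcal R}\hat\mu , \] where $\hat\mu=\mu_\infty\times\mu_{\mathrm{sf}}$ is the product measure on $(0,\infty)^2$ (with $\mu_\infty$ in the $\lambda_1$-coordinate and $\mu_{\mathrm{sf}}$ in the $\lambda_2$-coordinate) defined below.
   Context: $|\cdot|$ denotes the complex absolute value on $\mathbb{Z}[i]\subset\mathbb{C}$. A triple $(f,g,h)\in\mathbb{Z}[i]^3$ is called strongly carefree if $f,g,h$ are squarefree (in particular nonzero) and pairwise coprime in $\mathbb{Z}[i]$. For a nonzero prime ideal $\mathfrak p$ of $\mathbb{Z}[i]$, $\operatorname{Norm}(\mathfrak p)=\#(\mathbb{Z}[i]/\mathfrak p)$. The discrete measure $\mu_{\mathrm{sf}}$ on $\mathbb{R}_{>0}$ is $\mu_{\mathrm{sf}}=\sum_{g}\alpha(g)\,\delta_{|g|}$, the sum running over all squarefree $g\in\mathbb{Z}[i]$, where $\delta_t$ is the point mass at $t$ and \[ \alpha(g)=\frac{1}{|g|^2}\prod_{\mathfrak p\mid g}\frac{\operatorname{Norm}(\mathfrak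 p)}{\operatorname{Norm}(\mathfrak p)+2} \] (product over prime ideals dividing $g$). The continuous measure $\mu_\infty$ on $\mathbb{R}_{>0}$ is \[ d\mu_\infty(x)=\pi^2\prod_{\mathfrak p}\Bigl(1-\frac{3}{\operatorname{Norm}(\mathfrak p)^2}+\frac{2}{\operatorname{Norm}(\mathfrak p)^3}\Bigr)\,dx, \] the product over all nonzero prime ideals $\mathfrak p$ of $\mathbb{Z}[i]$. *)

(* Defs.v *)
From HB Require Import structures.
From mathcomp Require Import all_boot all_order all_algebra.
From mathcomp Require Import all_classical all_reals all_analysis.
From mathcomp Require Import finmap complex ring lra zify.
From mathcomp Require summability.
Import Order.TTheory GRing.Theory Num.Theory.
Import numFieldNormedType.Exports.

Set Implicit Arguments.
Unset Strict Implicit.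
Unset Printing Implicit Defensive.

Local Open Scope classical_set_scope.
Local Open Scope ring_scope.

Record gaussInt := GaussInt { gre : int; gim : int }.

Definition gaussInt_pair (z : gaussInt) : int * int := (gre z, gim z).
Definition pair_gaussInt (p : int * int) : gaussInt := GaussInt p.1 p.2.
Lemma gaussInt_pairK : cancel gaussInt_pair pair_gaussInt.
Proof. by case. Qed.

HB.instance Definition _ := Countable.copy gaussInt (can_type gaussInt_pairK).

Lemma gaussInt_eqP (x y : gaussInt) : gre x = gre y -> gim x = gim y -> x = y.
Proof. by case: x => a b; case: y => c d /= -> ->. Qed.

Definition gadd (x y : gaussInt) := GaussInt (gre x + gre y) (gim x + gim y).
Definition gopp (x : gaussInt) := GaussInt (- gre x) (- gim x).
Definition gmul (x y : gaussInt) :=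
  GaussInt (gre x * gre y - gim x * gim y) (gre x * gim y + gim x * gre y).

Fact gaddA : associative gadd.
Proof. by move=> x y z; apply: gaussInt_eqP => /=; ring. Qed.
Fact gaddC : commutative gadd.
Proof. by move=> x y; apply: gaussInt_eqP => /=; ring. Qed.
Fact gadd0 : left_id (GaussInt 0 0) gadd.
Proof. by move=> x; apply: gaussInt_eqP => /=; ring. Qed.
Fact gaddN : left_inverse (GaussInt 0 0) gopp gadd.
Proof. by move=> x; apply: gaussInt_eqP => /=; ring. Qed.

HB.instance Definition _ := GRing.isZmodule.Build gaussInt gaddA gaddC gadd0 gaddN.

Fact gmulA : associative gmul.
Proof. by move=> x y z; apply: gaussInt_eqP => /=; ring. Qed.
Fact gmulC : commutative gmul.
Proof. by move=> x y; apply: gaussInt_eqP => /=; ring. Qed.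
Fact gmul1 : left_id (GaussInt 1 0) gmul.
Proof. by move=> x; apply: gaussInt_eqP => /=; ring. Qed.
Fact gmulD : left_distributive gmul +%R.
Proof. by move=> x y z; apply: gaussInt_eqP => /=; ring. Qed.
Fact gone_neq0 : GaussInt 1 0 != 0.
Proof. by []. Qed.

HB.instance Definition _ := GRing.Zmodule_isComNzRing.Build gaussInt
  gmulA gmulC gmul1 gmulD gone_neq0.

Definition gnorm (x : gaussInt) : int := gre x ^+ 2 + gim x ^+ 2.
Definition gconj (x : gaussInt) := GaussInt (gre x) (- gim x).
Definition gunit : pred gaussInt := [pred x | gnorm x == 1].
Definition ginv (x : gaussInt) := if gunit x then gconj x else x.

Fact gmulV : {in gunit, left_inverse 1 ginv *%R}.
Proof.
move=> x; rewrite inE => x1; rewrite /ginv /gunit /= x1.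
move/eqP: x1 => x1; apply: gaussInt_eqP => /=; last by ring.
by rewrite -[RHS]x1 /gnorm; ring.
Qed.
Fact gunitP (x y : gaussInt) : y * x = 1 -> gunit x.
Proof.
move=> yx1; have: gnorm y * gnorm x = 1.
  by transitivity (gnorm (y * x)); [rewrite /gnorm /=; ring|rewrite yx1].
have x0 : 0 <= gnorm x by rewrite addr_ge0 ?sqr_ge0.
have y0 : 0 <= gnorm y by rewrite addr_ge0 ?sqr_ge0.
rewrite /gunit /=; case: (gnorm x) (gnorm y) x0 y0 => [m|//] [n|//] _ _.
by case=> /eqP; rewrite muln_eq1 => /andP[_ /eqP ->].
Qed.
Fact ginv_out : {in [predC gunit], ginv =1 id}.
Proof. by move=> x; rewrite /ginv; case: ifP => // xu; rewrite inE /= -topredE /= xu. Qed.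

HB.instance Definition _ := GRing.ComNzRing_hasMulInverse.Build gaussInt
  gmulV gunitP ginv_out.

Section gauss_abs.
Variable R : realType.
Implicit Types x y : gaussInt.

Definition gauss_complex x : R[i] := Complex (gre x)%:~R (gim x)%:~R.

Fact gauss_complex_zmod : zmod_morphism gauss_complex.
Proof. by move=> x y; apply/eqP; rewrite eq_complex /= !rmorphB !eqxx. Qed.
Fact gauss_complex_monoid : monoid_morphism gauss_complex.
Proof.
split=> // x y; apply/eqP.
by rewrite eq_complex /= rmorphB rmorphD !rmorphM !eqxx.
Qed.
HB.instance Definition _ :=
  GRing.isZmodMorphism.Build gaussInt R[i] gauss_complex gauss_complex_zmod.
HB.instance Definition _ :=
  GRing.isMonoidMorphism.Build gaussInt R[i] gauss_complex gauss_complex_monoid.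

(* Complex absolute value, through the embedding in R[i]; [normc] is the R-valued
   form of the norm `| | of R[i]. *)
Definition gabs x : R := ComplexField.Normc.normc (gauss_complex x).

End gauss_abs.

Section arithmetic.
Implicit Types f g h d : gaussInt.

Definition gdvd d f : Prop := exists e, f = e * d.

Definition squarefree f : Prop :=
  f != 0 /\ forall d, gdvd (d ^+ 2) f -> d \is a GRing.unit.

Definition gcoprime f g : Prop :=
  forall d, gdvd d f -> gdvd d g -> d \is a GRing.unit.

Definition strongly_carefree f g h : Prop :=
  [/\ squarefree f, squarefree g & squarefree h] /\
  [/\ gcoprime f g, gcoprime f h & gcoprime g h].

(* [idealr_closed] includes properness (1 is not in p). *)
Definition nonzero_prime : set (set gaussInt) :=
  [set p : set gaussInt | [/\ idealr_closed [in p], prime_idealr_closed [in p] &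
               exists2 x, x \in p & x != 0]].

(* The quotient Z[i]/p as the set of cosets x + p. *)
Definition cosets (p : set gaussInt) : set (set gaussInt) :=
  [set [set x + y | y in p] | x in [set: gaussInt]].

(* [fset_set] sends an infinite set to the empty one; Z[i]/p is finite for every
   nonzero ideal p. *)
Definition ideal_norm (p : set gaussInt) : nat := #|` fset_set (cosets p)|%fset.

End arithmetic.

#[global] Existing Instance summability.totally_filter.

(* The discrete measure is built on [measurableTypeR R] because the library's
   Lebesgue measure lives there; its sigma-algebra is the Borel one of R. *)
Section measures.
Variable R : realType.
Local Open Scope ereal_scope.

(* The primes p dividing g are those with g in p; for g != 0 they are finitely
   many, so the finitely supported product below is the actual product. *)
Definition alpha (g : gaussInt) : R :=
  ((gabs R g ^+ 2)^-1 *
   \big[*%R/1]_(p \in [set p | nonzero_prime p /\ g \in p])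
     ((ideal_norm p)%:R / ((ideal_norm p)%:R + 2) : R))%R.

Lemma alpha_ge0 g : (0 <= alpha g)%R.
Proof.
apply: mulr_ge0; first by rewrite invr_ge0 sqr_ge0.
by apply: prodr_ge0 => p _; rewrite divr_ge0 ?addr_ge0.
Qed.

Definition mu_sf (A : set (measurableTypeR R)) : \bar R :=
  \esum_(g in [set g | squarefree g]) ((alpha g)%:E * \d_(gabs R g) A).

Let term_ge0 g (A : set (measurableTypeR R)) : 0 <= (alpha g)%:E * \d_(gabs R g) A.
Proof. by rewrite mule_ge0 // lee_fin alpha_ge0. Qed.

Let mu_sf0 : mu_sf set0 = 0.
Proof. by rewrite /mu_sf esum1 // => g _; rewrite measure0 mule0. Qed.

Let mu_sf_ge0 A : 0 <= mu_sf A.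
Proof. exact: esum_ge0. Qed.

Let mu_sf_sigma_additive : semi_sigma_additive mu_sf.
Proof.
move=> F mF tF mUF; rewrite [X in _ --> X](_ : _ = \sum_(n <oo) mu_sf (F n)).
  exact: is_cvg_nneseries.
rewrite nneseries_esumT // /mu_sf.
transitivity (\esum_(g in [set g | squarefree g]) \esum_(n in [set: nat])
    ((alpha g)%:E * \d_(gabs R g) (F n))).
  apply: eq_esum => g _; rewrite -nneseries_esumT // nneseriesZl //.
  by rewrite measure_semi_bigcup.
rewrite !esum_esum //.
rewrite (reindex_esum ([set: nat] `*` [set g | squarefree g]) _
  (fun x => (x.2, x.1))) //.
split => [[n g] []|[n g] [m k] _ _ [] -> ->|[g n] []] //= gP _.
by exists (n, g).
Qed.

HB.instance Definition _ := isMeasure.Build _ _ _ mu_sf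
  mu_sf0 mu_sf_ge0 mu_sf_sigma_additive.

Let gabs_finite (n : nat) : finite_set [set g | (gabs R g <= n%:R)%R].
Proof.
apply: (@sub_finite_set _ _ ((fun p : nat * nat =>
   GaussInt (p.1%:Z - n%:Z)%R (p.2%:Z - n%:Z)%R) @` (`I_(n.*2.+1) `*` `I_(n.*2.+1)))).
  move=> g /= gn.
  have gn2 : (gre g ^+ 2 + gim g ^+ 2 <= n%:Z ^+ 2)%R.
    rewrite -(ler_int R) rmorphD !rmorphXn /=.
    have : (gabs R g ^+ 2 <= n%:R ^+ 2)%R.
      by rewrite ler_pXn2r // nnegrE ?ler0n // /gabs /= sqrtr_ge0.
    by rewrite /gabs /= sqr_sqrtr // addr_ge0 ?sqr_ge0.
  exists (absz (gre g + n%:Z)%R, absz (gim g + n%:Z)%R).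
    by split => /=; nia.
  by apply: gaussInt_eqP => /=; nia.
by apply: finite_image; apply: finite_setX; exact: finite_II.
Qed.

Let mu_sf_sigma_finite : sigma_finite [set: measurableTypeR R] mu_sf.
Proof.
exists (fun n => [set` `]-oo, n%:R]]%R).
  apply/seteqP; split => // x _; exists (Num.bound `|x|) => //=.
  by rewrite in_itv /= (le_trans (ler_norm _)) // ltW // archi_boundP.
move=> n; split => //.
have -> : mu_sf [set` `]-oo, n%:R]]%R =
  \esum_(g in [set g | squarefree g] `&` [set g | (gabs R g <= n%:R)%R])
     (alpha g)%:E.
  rewrite esum_mkcondr; apply: eq_esum => g _; rewrite diracE.
  have -> : (gabs R g \in [set` `]-oo, n%:R]]%R) =
            (g \in [set g | (gabs R g <= n%:R)%R]).
    by apply/idP/idP => /set_mem gn; apply/mem_set; move: gn; rewrite /= in_itv.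
  by case: ifP => _; rewrite ?mule1 ?mule0.
have fin := sub_finite_set (@subIsetr _ [set g | squarefree g] _) (gabs_finite n).
rewrite esum_fset //; last by move=> g _; rewrite lee_fin alpha_ge0.
by rewrite fsbig_finite //= sumEFin ltry.
Qed.

HB.instance Definition _ :=
  Measure_isSigmaFinite.Build _ _ _ mu_sf mu_sf_sigma_finite.

Definition euler_factor (p : set gaussInt) : R :=
  (1 - 3 / (ideal_norm p)%:R ^+ 2 + 2 / (ideal_norm p)%:R ^+ 3)%R.

Definition euler_partial (A : {fset nonzero_prime}) : R :=
  (\prod_(p <- A) euler_factor (val p))%R.

(* The (unconditionally convergent) product over all nonzero primes: limit
   along the finite sets of primes, directed by inclusion. *)
Definition euler_product : R :=
  lim (euler_partial A @[A --> summability.totally]).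

Fact euler_factor01 p : (0 <= euler_factor p <= 1)%R.
Proof.
rewrite /euler_factor; case: (ideal_norm p) => [|n].
  by rewrite !expr0n /= !invr0 !mulr0 subr0 addr0 ler01 lexx.
set x := (n.+1%:R^-1 : R)%R.
have x1 : (0 <= x <= 1)%R by rewrite invr_ge0 ler0n invf_le1 ?ltr0n // ler1n.
rewrite -!exprVn -/x.
have -> : (1 - 3 * x ^+ 2 + 2 * x ^+ 3 = (1 - x) ^+ 2 * (1 + 2 * x))%R by ring.
apply/andP; split; first by rewrite mulr_ge0 ?sqr_ge0 //; lra.
rewrite -subr_ge0 (_ : _ - _ = x ^+ 2 * (3 - 2 * x))%R; last by ring.
by rewrite mulr_ge0 ?sqr_ge0 //; lra.
Qed.

Fact euler_partial_ge0 A : (0 <= euler_partial A)%R.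
Proof. by apply: prodr_ge0 => p _; case/andP: (euler_factor01 (val p)). Qed.

Fact euler_partial_le (A B : {fset nonzero_prime}) :
  (A `<=` B)%fset -> (euler_partial B <= euler_partial A)%R.
Proof.
move=> AB; rewrite /euler_partial (big_fsetID _ (fun p => p \in A)) /=.
have -> : [fset x in B | x \in A]%fset = A.
  by apply/fsetP => p; rewrite !inE /= andbC;
     case: (boolP (p \in A)) => //= /(fsubsetP AB) ->.
rewrite ler_piMr //.
  by apply: prodr_ge0 => p _; case/andP: (euler_factor01 (val p)).
by apply: prodr_ile1 => p _; exact: euler_factor01.
Qed.

Lemma is_cvg_euler_partial :
  cvg (euler_partial A @[A --> summability.totally]).
Proof.
pose E := range euler_partial.
have hE : has_inf E.
  split; first by exists (euler_partial fset0); exists fset0.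
  by exists 0%R => _ [A _ <-]; exact: euler_partial_ge0.
apply/cvg_ex; exists (inf E); apply/cvgrPdist_le => e e0.
have [_ [A _ <-] Ae] := inf_adherent e0 hE.
exists A => // B /= AB.
have infB : (inf E <= euler_partial B)%R.
  by apply: ge_inf; [exact: hE.2 | exists B].
rewrite distrC ger0_norm ?subr_ge0 // lerBlDl.
exact: le_trans (euler_partial_le AB) (ltW Ae).
Qed.

Fact mu_infty_density_ge0 : (0 <= pi ^+ 2 * euler_product)%R.
Proof.
rewrite mulr_ge0 ?sqr_ge0 //; apply: limr_ge; first exact: is_cvg_euler_partial.
by near=> A; exact: euler_partial_ge0.
Unshelve. all: by end_near. Qed.

(* Measures on R_{>0} are taken on the whole line, with no mass outside
   ]0, +oo[: hence the restriction here, while mu_sf only charges the values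
   |g| with g != 0. *)
Definition mu_infty : set (measurableTypeR R) -> \bar R :=
  mscale (NngNum mu_infty_density_ge0)
    (mrestr (@lebesgue_measure R) (measurable_itv `]0%R, +oo[)).

HB.instance Definition _ := Measure.on mu_infty.

Definition mu_hat : set (measurableTypeR R * measurableTypeR R) -> \bar R :=
  mu_infty \x mu_sf.

HB.instance Definition _ := Measure.on mu_hat.

End measures.

Arguments mu_sf : clear implicits.
Arguments mu_infty : clear implicits.
Arguments mu_hat : clear implicits.

Section counting.
Variable R : realType.

Definition height (t : gaussInt * gaussInt * gaussInt) : R :=
  let: (f, g, h) := t in gabs R f * gabs R g ^+ 2 * gabs R h ^+ 3.

Definition shape (t : gaussInt * gaussInt * gaussInt) : R * R :=
  let: (f, g, h) := t in (gabs R f / gabs R h, gabs R g).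

Definition carefree_triples (D : set (R * R)) (X : R) :
    set (gaussInt * gaussInt * gaussInt) :=
  [set t | [/\ strongly_carefree t.1.1 t.1.2 t.2, height t <= X & D (shape t)]].

(* For D inside [a, b] x [c, d] with a, c > 0, the set of triples is finite:
   the height bounds |h| through |f| >= a|h| and |g| >= c, then |f| <= b|h| and
   |g| <= d. *)
Definition carefree_count (D : set (R * R)) (X : R) : nat :=
  #|` fset_set (carefree_triples D X)|%fset.

End counting.

(* Main.v *)
From HB Require Import structures.
Require Import Defs.
From mathcomp Require Import all_boot all_order all_algebra.
From mathcomp Require Import all_classical all_reals all_analysis.
From mathcomp Require Import finmap complex ring lra zify.
Import Order.TTheory GRing.Theory Num.Theory.
Import numFieldNormedType.Exports.
Import Defs.
Local Open Scope classical_set_scope.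
Local Open Scope ring_scope.

(* For fixed g, the pairs (f, h) with |f|/|h| in [a, b] and |f| |h|^3 <= T^4 form
   a homogeneously expanding region of C^2.  Summing the count of f over h and
   using the Gauss circle asymptotics twice, those with d | f and e | h number
   ~ pi^2 (b - a) T^4 / (N(d) N(e)).

   The conditions imposed at finitely many primes are then sieved out one prime
   at a time by inclusion-exclusion: only homogeneous conditions d | f, e | h
   ever occur, so residue classes and the Chinese remainder theorem are not
   needed.  A pair violating a condition at a prime of norm > z has d^2 | f,
   d^2 | h or d | f, h for some d with N(d) > z, which happens for at most
   O(T^4 sum_(N(d) > z) N(d)^-2) pairs; since the series converges, z may tend to
   infinity.  With T^4 = X / |g|^2, summing over the finitely many g gives the
   theorem. *)

(** Each limit in T is taken at fixed moduli d and e, so the asymptotic inputs are only used in the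
    weak form |n(t) - A t^k| <= eps t^k + C, without rate and without uniformity in the moduli.
    Uniformity enters once, through the upper bound K T^4 / (N(d) N(e)) for all nonzero d and e; it
    carries no additive term because f = 0 and h = 0 lie outside the region. It controls the large
    primes for every T > 0 at once, and this is what lets T tend to infinity before z does.

    The lattice points of a disc and the pairs (f, h) are counted by one and the same statement, on
    the sum of a counting function over points sorted by size. The Gauss circle asymptotics is thus
    proved here, from the count of integers in an interval.

    The weight in [alpha] is a ratio of local factors: at a prime of norm N the sieve leaves (1 -
    1/N)^2 if the prime divides g, and (1 - 1/N)^2 (1 + 2/N) otherwise. Extracting the second
    expression at every prime gives an Euler product independent of g and leaves N/(N + 2) at the
    primes dividing g. *)

Set Implicit Arguments.
Unset Strict Implicit.
Unset Printing Implicit Defensive.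

(** * Gaussian integers *)

Section gauss_arithmetic.
Implicit Types c d e x y z : gaussInt.

Lemma gnormM x y : gnorm (x * y) = gnorm x * gnorm y.
Proof. by rewrite /gnorm /=; ring. Qed.

Lemma gnorm_ge0 x : 0 <= gnorm x.
Proof. by rewrite addr_ge0 ?sqr_ge0. Qed.

Lemma gnorm_eq0 x : (gnorm x == 0) = (x == 0).
Proof.
rewrite paddr_eq0 ?sqr_ge0 // !sqrf_eq0; apply/andP/eqP => [[/eqP a /eqP b]|-> //].
exact: gaussInt_eqP.
Qed.

Lemma gnorm_gt0 x : (0 < gnorm x) = (x != 0).
Proof. by rewrite lt_def gnorm_eq0 gnorm_ge0 andbT. Qed.

Lemma gaussInt_integral : GRing.integral_domain_axiom gaussInt.
Proof. by move=> x y xy; rewrite -!gnorm_eq0 -mulf_eq0 -gnormM xy. Qed.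

End gauss_arithmetic.

HB.instance Definition _ :=
  GRing.ComUnitRing_isIntegral.Build gaussInt gaussInt_integral.

Section gauss_arithmetic.
Implicit Types c d e x y z : gaussInt.

Lemma gunitE x : (x \is a GRing.unit) = (gnorm x == 1).
Proof. by []. Qed.

Lemma gdvd_refl x : gdvd x x.
Proof. by exists 1; rewrite mul1r. Qed.

Lemma gdvd_trans y x z : gdvd x y -> gdvd y z -> gdvd x z.
Proof. by move=> [e ->] [f ->]; exists (f * e); rewrite mulrA. Qed.

Lemma gdvd_mull d x y : gdvd d y -> gdvd d (x * y).
Proof. by move=> [e ->]; exists (x * e); rewrite mulrA. Qed.

Lemma gdvdD d x y : gdvd d x -> gdvd d y -> gdvd d (x + y).
Proof. by move=> [e ->] [f ->]; exists (e + f); rewrite mulrDl. Qed.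

Lemma gdvd_unit x d : gdvd d x -> x \is a GRing.unit -> d \is a GRing.unit.
Proof. by move=> [e ->]; rewrite unitrM => /andP[]. Qed.

Lemma gdvd_gnorm_le d x : x != 0 -> gdvd d x -> gnorm d <= gnorm x.
Proof.
move=> + [e xE]; rewrite xE mulf_eq0 negb_or => /andP[e0 d0].
by rewrite gnormM ler_peMl ?gnorm_ge0 // -gtz0_ge1 gnorm_gt0.
Qed.

Lemma gdvd_gnorm_eq d x : x != 0 -> gdvd d x -> gnorm x <= gnorm d -> gdvd x d.
Proof.
move=> + [e xE]; rewrite xE mulf_eq0 negb_or => /andP[e0 d0].
rewrite gnormM -[leRHS]mul1r ler_pM2r ?gnorm_gt0 // => e1.
have eu : e \is a GRing.unit by rewrite gunitE eq_le e1 -gtz0_ge1 gnorm_gt0.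
by exists e^-1; rewrite mulKr.
Qed.

(** * Euclidean division, principal ideals and prime elements *)

Lemma int_round (u n : int) : 0 < n -> exists q : int, `|2 * (u - q * n)| <= n.
Proof.
move=> n0; exists ((2 * u + n) %/ (2 * n))%Z.
have n2 : 2 * n != 0 by rewrite mulf_neq0 // gt_eqF.
have := divz_eq (2 * u + n) (2 * n); have := modz_ge0 (2 * u + n) n2.
have : ((2 * u + n) %% (2 * n))%Z < 2 * n by rewrite ltz_pmod // mulr_gt0.
move: (_ %/ _)%Z (_ %% _)%Z => q r; rewrite ler_norml; lia.
Qed.

(** Both coordinates of x conj(d) / N(d) are rounded to a nearest integer. Each is then off by at
    most 1/2, so the remainder has norm at most N(d)/2. Multiplying by N(d) keeps the comparison
    within the integers. *)
Lemma gauss_euclid x d : d != 0 -> exists q, gnorm (x - q * d) < gnorm d.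
Proof.
move=> d0; have n0 : 0 < gnorm d by rewrite gnorm_gt0.
have [q1 h1] := int_round (gre (x * gconj d)) n0.
have [q2 h2] := int_round (gim (x * gconj d)) n0.
exists (GaussInt q1 q2); rewrite -(ltr_pM2r n0).
have nc : gnorm (gconj d) = gnorm d by rewrite /gnorm /= sqrrN.
have -> : gnorm (x - GaussInt q1 q2 * d) * gnorm d =
    (gre (x * gconj d) - q1 * gnorm d) ^+ 2 +
    (gim (x * gconj d) - q2 * gnorm d) ^+ 2.
  by rewrite -[X in _ * X]nc -gnormM /gnorm /=; ring.
move: h1 h2; set u := gre _ - _; set v := gim _ - _.
move: u v (gnorm d) n0 => u v n n0.
rewrite !ler_norml; nia.
Qed.

(** An element of least nonzero norm generates. The statement is on bare sets closed under
    [a * u + v], so that it serves both for prime ideals and for the ideal (c, x), whose generator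
    is a gcd of c and x. *)
Lemma gauss_principal (p : set gaussInt) : p 0 ->
  (forall a u v, p u -> p v -> p (a * u + v)) ->
  exists2 d, p d & forall x, p x -> gdvd d x.
Proof.
move=> p0 pL.
have [[x [px x0]]|np] := pselect (exists x, p x /\ x != 0); last first.
  exists 0 => // x px; exists 0; rewrite mul0r.
  by apply: contrapT => /eqP x0; apply: np; exists x.
have ex : exists n, `[< exists y, [/\ p y, y != 0 & `|gnorm y|%N = n] >].
  by exists `|gnorm x|%N; apply/asboolP; exists x.
case: (ex_minnP ex) => n /asboolP[d [pd d0 dn]] hmin; exists d => // y py.
have [q hq] := gauss_euclid y d0.
have pr : p (y - q * d) by rewrite addrC -mulNr; exact: pL.
exists q; apply/eqP; rewrite -subr_eq0; apply/negPn/negP => r0.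
have /hmin : `[< exists z, [/\ p z, z != 0 & `|gnorm z|%N = absz (gnorm (y - q * d))] >].
  by apply/asboolP; exists (y - q * d).
by rewrite -dn leqNgt; have := gnorm_ge0 (y - q * d); lia.
Qed.

Definition gprime (pi : gaussInt) : Prop :=
  [/\ pi != 0, pi \isn't a GRing.unit &
    forall x y, gdvd pi (x * y) -> gdvd pi x \/ gdvd pi y].

(** A non-unit divisor c of least norm is prime. If c divides x y, let e be a gcd of c and x: when e
    is a unit, Bezout gives c | y; otherwise minimality of the norm makes e an associate of c, and c
    | x. *)
Lemma exists_gprime_dvd d : d != 0 -> d \isn't a GRing.unit ->
  exists2 pi, gprime pi & gdvd pi d.
Proof.
move=> d0 du.
have ex : exists n, `[< exists y, [/\ gdvd y d, y \isn't a GRing.unit &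
    `|gnorm y|%N = n] >].
  by exists `|gnorm d|%N; apply/asboolP; exists d; split => //; exact: gdvd_refl.
case: (ex_minnP ex) => n /asboolP[c [cd cu cn]] hmin; exists c => //.
have c0 : c != 0.
  by apply: contraNneq d0 => c0; case: cd => e ->; rewrite c0 mulr0.
split => // x y cxy; apply: contrapT => /not_orP[ncx ncy].
have [| |e [u [v eE]] he] := @gauss_principal [set z | exists u v, z = u * c + v * x].
- by exists 0, 0; rewrite !mul0r addr0.
- move=> a _ _ [u [v ->]] [u' [v' ->]]; exists (a * u + u'), (a * v + v').
  by rewrite !mulrDl mulrDr !mulrA addrACA.
have ec : gdvd e c by apply: he; exists 1, 0; rewrite mul1r mul0r addr0.
have ex' : gdvd e x by apply: he; exists 0, 1; rewrite mul1r mul0r add0r.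
have [eu|enu] := boolP (e \is a GRing.unit).
  apply: ncy; have -> : y = e^-1 * (u * y * c + v * (x * y)).
    by rewrite -[LHS](mulKr eu) eE; congr (_ * _); ring.
  by apply: gdvd_mull; apply: gdvdD; apply: gdvd_mull => //; exact: gdvd_refl.
apply: ncx; apply: gdvd_trans ex'; apply: gdvd_gnorm_eq => //.
have /hmin : `[< exists z, [/\ gdvd z d, z \isn't a GRing.unit &
    `|gnorm z|%N = `|gnorm e|%N] >].
  by apply/asboolP; exists e; split => //; exact: gdvd_trans cd.
by rewrite -cn; have := gnorm_ge0 e; have := gnorm_ge0 c; lia.
Qed.

Definition principal (d : gaussInt) : set gaussInt := [set x | gdvd d x].

Lemma nonzero_primeP p :
  nonzero_prime p <-> exists2 pi, gprime pi & p = principal pi.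
Proof.
split => [[[p0 p1 pL] pP [x px x0]]|[d [d0 du dP] ->]]; last first.
  split.
  - split; first by apply/mem_set; exists 0; rewrite mul0r.
      by apply/negP => /set_mem/gdvd_unit; rewrite unitr1 (negbTE du) => /(_ isT).
    move=> a u v /set_mem du' /set_mem dv; apply/mem_set.
    by apply: gdvdD => //; exact: gdvd_mull.
  - move=> u v /set_mem /dP[h|h]; apply/orP; [left|right]; exact/mem_set.
  - by exists d => //; apply/mem_set; exact: gdvd_refl.
have [| |d pd hd] := @gauss_principal p; first exact/set_mem.
  by move=> a u v pu pv; apply/set_mem/pL; exact/mem_set.
have pE : p = principal d.
  apply/seteqP; split => // y [e ->]; rewrite -[e * d]addr0.
  by apply/set_mem; apply: pL => //; exact/mem_set.
exists d => //; split.
- apply: contraNneq x0 => d0; have [e ->] := hd _ (set_mem px).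
  by rewrite d0 mulr0.
- apply: contraNN p1 => du; rewrite -(mulVr du) -[_ * d]addr0.
  by apply: pL => //; exact/mem_set.
- move=> u v duv; have : p (u * v) by rewrite pE.
  by move=> /mem_set/pP/orP[]/set_mem; rewrite pE; [left|right].
Qed.

Lemma principal_inj c d : c != 0 -> principal c = principal d -> gnorm c = gnorm d.
Proof.
move=> c0 cd.
have h1 : gdvd c d by change (principal c d); rewrite cd; exact: gdvd_refl.
have h2 : gdvd d c by change (principal d c); rewrite -cd; exact: gdvd_refl.
have d0 : d != 0.
  by apply: contraNneq c0 => d0; case: h2 => e ->; rewrite d0 mulr0.
by apply/eqP; rewrite eq_le !gdvd_gnorm_le.
Qed.

Lemma eq_dvdz_lt (n a b : nat) :
  (a < n)%N -> (b < n)%N -> (n%:Z %| a%:Z - b%:Z)%Z -> a = b.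
Proof. by move=> an bn; rewrite -eqz_mod_dvd !modz_nat !modn_small // => /eqP[]. Qed.

(* For d = x + iy and g = gcd(x, y), the a + ib with 0 <= a < N(d)/g and
   0 <= b < g represent Z[i]/(d): the ideal contains N(d)/g, and an element of
   imaginary part g. *)
Section ideal_norm_principal.
Variable d : gaussInt.
Hypothesis d0 : d != 0.
Let g := `|gcdz (gre d) (gim d)|%N.
Let m := (`|gnorm d| %/ g)%N.

Let gE : g%:Z = gcdz (gre d) (gim d). Proof. by []. Qed.
Let g_re : (g%:Z %| gre d)%Z. Proof. by rewrite gE dvdz_gcdl. Qed.
Let g_im : (g%:Z %| gim d)%Z. Proof. by rewrite gE dvdz_gcdr. Qed.

Let g_gt0 : (0 < g)%N.
Proof.
rewrite lt0n; apply: contra d0 => /eqP g0.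
have /eqP : gcdz (gre d) (gim d) = 0 by rewrite -gE g0.
rewrite gcdz_eq0 => /andP[/eqP h1 /eqP h2].
by apply/eqP; exact: gaussInt_eqP.
Qed.

Let normE : (m * g)%N = `|gnorm d|%N.
Proof.
apply: divnK; suff : (g%:Z %| gnorm d)%Z by [].
by rewrite /gnorm rpredD // expr2 dvdz_mulr.
Qed.

Let norm_gt0 : (0 < `|gnorm d|)%N.
Proof. by rewrite absz_gt0 gnorm_eq0. Qed.

Let m_gt0 : (0 < m)%N.
Proof. by move: norm_gt0; rewrite -normE muln_gt0 => /andP[]. Qed.

Let normZ : gnorm d = m%:Z * g%:Z.
Proof. by rewrite -PoszM normE gez0_abs // gnorm_ge0. Qed.

Let rep (k : nat) := GaussInt (k %% m)%N (k %/ m)%N.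

Let m_in : gdvd d (GaussInt m 0).
Proof.
have [x' xE] := dvdzP g_re; have [y' yE] := dvdzP g_im.
(* This cofactor is conj(d)/g, and d conj(d)/g = N(d)/g = m. *)
exists (GaussInt x' (- y')).
have := normZ; rewrite /gnorm => h.
have g0 : g%:Z != 0 by rewrite eqz_nat -lt0n.
apply: gaussInt_eqP => /=; apply: (mulIf g0).
  by rewrite -h mulNr opprK mulrDl mulrAC -xE mulrAC -yE; ring.
by rewrite mul0r mulrDl mulrAC -xE mulNr mulNr mulrAC -yE; ring.
Qed.

Let g_in : exists c : int, gdvd d (GaussInt c g).
Proof.
have [u [v uv]] := Bezoutz (gre d) (gim d).
(* The imaginary part of (v + iu) d is u Re d + v Im d, which the Bezout relation makes equal to
   g. *)
exists (v * gre d - u * gim d), (GaussInt v u).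
by apply: gaussInt_eqP => //=; rewrite gE -uv addrC.
Qed.

Let rep_surj z : exists2 k, (k < `|gnorm d|)%N & gdvd d (z - rep k).
Proof.
have [c hc] := g_in.
pose q := (gim z %/ g)%Z; pose b := (gim z %% g)%Z.
have g0 : g%:Z != 0 by rewrite eqz_nat -lt0n.
have m0 : m%:Z != 0 by rewrite eqz_nat -lt0n.
have b0 : 0 <= b by rewrite modz_ge0.
have bg : b < g by rewrite ltz_pmod.
pose r := gre z - q * c; pose s := (r %/ m)%Z; pose a := (r %% m)%Z.
have a0 : 0 <= a by rewrite modz_ge0.
have am : a < m by rewrite ltz_pmod.
exists (`|b| * m + `|a|)%N; first by rewrite -normE; nia.
rewrite /rep modnMDl divnMDl // modn_small ?divn_small ?addn0; try lia.
rewrite !gez0_abs //.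
have -> : z - GaussInt a b =
    GaussInt q 0 * GaussInt c g + GaussInt s 0 * GaussInt m 0.
  have := divz_eq (gim z) g; have := divz_eq r m; rewrite -/q -/b -/s -/a => h1 h2.
  apply: gaussInt_eqP => /=; last by rewrite h2; ring.
  have -> : gre z = r + q * c by rewrite /r subrK.
  by rewrite h1; ring.
by apply: gdvdD; exact: gdvd_mull.
Qed.

Let rep_inj k l : (k < `|gnorm d|)%N -> (l < `|gnorm d|)%N ->
  gdvd d (rep k - rep l) -> k = l.
Proof.
rewrite -normE => kN lN [e [eRe eIm]].
have bk : (k %/ m < g)%N by rewrite ltn_divLR // mulnC.
have bl : (l %/ m < g)%N by rewrite ltn_divLR // mulnC.
have beq : (k %/ m = l %/ m)%N.
  apply: (eq_dvdz_lt bk bl).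
  by rewrite [X in (_ %| X)%Z]eIm rpredD // dvdz_mull.
(* The imaginary parts agree, so the difference is a rational integer A in the ideal (d).
   Multiplying A = e d by conj(d) shows that N(d) divides A Re d and A Im d, hence A g by Bezout;
   since N(d) = m g, it follows that m divides A. *)
have : (m%:Z * g%:Z %| ((k %% m)%N%:Z - (l %% m)%N%:Z) * g%:Z)%Z.
  have [u [v uv]] := Bezoutz (gre d) (gim d); rewrite -normZ gE -uv.
  have h : GaussInt ((k %% m)%N%:Z - (l %% m)%N%:Z) 0 = e * d.
    by apply: gaussInt_eqP => //=; rewrite -eIm beq subrr.
  have hd : GaussInt ((k %% m)%N%:Z - (l %% m)%N%:Z) 0 * gconj d =
     e * GaussInt (gnorm d) 0.
    by rewrite h -mulrA; congr (_ * _); apply: gaussInt_eqP => /=; rewrite /gnorm; ring.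
  move: hd; move: (_%:Z - _) => a hd.
  have h1 : a * gre d = gre e * gnorm d.
    by have := congr1 gre hd; congr (_ = _); rewrite /=; ring.
  have h2 : a * gim d = - gim e * gnorm d.
    by apply: oppr_inj; have := congr1 gim hd; congr (_ = _); rewrite /=; ring.
  apply/dvdzP; exists (u * gre e - v * gim e).
  by rewrite mulrDr mulrCA h1 [a * (v * _)]mulrCA h2; ring.
rewrite dvdz_mul2r; last by rewrite eqz_nat -lt0n.
have ak : (k %% m < m)%N by rewrite ltn_pmod.
have al : (l %% m < m)%N by rewrite ltn_pmod.
move=> /(eq_dvdz_lt ak al) aeq.
by rewrite (divn_eq k m) (divn_eq l m) beq aeq.
Qed.

Lemma ideal_norm_principal : ideal_norm (principal d) = `|gnorm d|%N.
Proof.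
rewrite /ideal_norm; apply: card_fset_set.
pose coset x := [set x + y | y in principal d].
have cosetE x y : coset x = coset y <-> gdvd d (x - y).
  split => [xy|xy].
    have : coset x x by exists 0; [exists 0; rewrite mul0r|rewrite addr0].
    by rewrite xy => -[z dz <-]; rewrite addrC addKr.
  have sub a b : gdvd d (a - b) -> coset a `<=` coset b.
    move=> ab _ [z dz <-]; exists (a - b + z); first exact: gdvdD.
    by rewrite addrA addrCA subrr addr0.
  apply/seteqP; split; apply: sub => //.
  by rewrite -opprB -mulN1r; exact: gdvd_mull.
have -> : cosets (principal d) = (coset \o rep) @` `I_(`|gnorm d|%N).
  apply/seteqP; split => [_ [z _ <-]|_ [k _ <-]]; last by exists (rep k).
  by have [k kN hk] := rep_surj z; exists k => //; apply/esym/cosetE.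
apply: inj_card_eq => k l /set_mem kN /set_mem lN /cosetE; exact: rep_inj.
Qed.

End ideal_norm_principal.

End gauss_arithmetic.

(** * Riemann sums over counting functions *)

Lemma cvg_pinftyP (R : realType) (f : R -> R) (l : R) :
  (f x @[x --> +oo] --> l) <->
  (forall e : R, 0 < e -> exists M : R, forall x, M <= x -> `|f x - l| <= e).
Proof.
split.
  move=> /cvgrPdist_le h e e0; have [M [_ hM]] := h e e0.
  exists (M + 1) => x Mx; rewrite distrC; apply: hM.
  by apply: lt_le_trans Mx; rewrite ltrDl.
move=> h; apply/cvgrPdist_le => e e0; have [M hM] := h e e0.
exists M; split; first exact: num_real.
by move=> x Mx; rewrite distrC; apply: hM; exact: ltW.
Qed.

Lemma cvg_sumr (R : realType) (T : Type) (F : set_system T) (FF : Filter F)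
  (I : Type) (r : seq I) (P : pred I) (f : I -> T -> R) (l : I -> R) :
  (forall i, P i -> f i x @[x --> F] --> l i) ->
  (\sum_(i <- r | P i) f i x) @[x --> F] --> \sum_(i <- r | P i) l i.
Proof.
move=> h; elim: r => [|i r IH].
  by rewrite big_nil; under eq_fun do rewrite big_nil; exact: cvg_cst.
rewrite big_cons; under eq_fun do rewrite big_cons.
by case: ifP => // /h hi; exact: cvgD.
Qed.

Lemma cvg_invXn_pinfty (R : realType) (k : nat) (C : R) :
  (0 < k)%N -> (C / x ^+ k) @[x --> +oo] --> (0 : R).
Proof.
move=> k0; apply/cvg_pinftyP => e e0.
exists (1 + `|C| / e) => x Mx.
have Ce : 0 <= `|C| / e by rewrite divr_ge0 // ltW.
have x1 : 1 <= x by apply: le_trans Mx; rewrite lerDl.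
have x0 : 0 < x by apply: lt_le_trans x1.
rewrite subr0 normrM normfV (ger0_norm (exprn_ge0 _ (ltW x0))).
rewrite ler_pdivrMr ?exprn_gt0 //.
have : x <= x ^+ k by rewrite -[leLHS]expr1 ler_weXn2l.
have : `|C| <= x * e.
  by rewrite -ler_pdivrMr //; apply: le_trans Mx; rewrite lerDr.
move=> h1 h2; apply: (le_trans h1); rewrite mulrC ler_pM2l //.
Qed.

Section riemann_count.
Variables (R : realType) (I : choiceType) (pos : I -> R) (Q : R -> {fset I}).
Hypothesis QE : forall s t : R, s <= t ->
  forall y, (y \in Q s) = (y \in Q t) && (pos y <= s).

Let card_slab (s t : R) : s <= t ->
  (\sum_(y <- Q t | s < pos y) 1 : R) = #|` Q t|%:R - #|` Q s|%:R.
Proof.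
move=> st; rewrite !card_fset_sum1 !natr_sum /=.
rewrite [X in X - _](bigID (fun y => s < pos y)) /=.
rewrite [X in _ + X - _](_ : _ = \sum_(y <- Q s) 1); first by rewrite addrK.
rewrite -big_filter; apply: perm_big; apply: uniq_perm.
- by rewrite filter_uniq // fset_uniq.
- exact: fset_uniq.
by move=> y; rewrite mem_filter -leNgt (QE st) andbC.
Qed.

Variables (B : R) (be : nat).
Hypothesis cardQ : forall s : R, 0 <= s ->
  (#|` Q (s * T)|%:R / T ^+ be) @[T --> +oo] --> B * s ^+ be.

Let slab_approx (s t : R) (f : I -> R) (c e : R) : s <= t ->
  (forall y, y \in Q t -> s < pos y -> `|f y - c| <= e) ->
  `|\sum_(y <- Q t | s < pos y) f y - c * (#|` Q t|%:R - #|` Q s|%:R)|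
    <= e * (#|` Q t|%:R - #|` Q s|%:R).
Proof.
move=> st hf; rewrite -!card_slab // !mulr_sumr -sumrB.
apply: le_trans (ler_norm_sum _ _ _) _.
rewrite big_seq_cond [leRHS]big_seq_cond; apply: ler_sum => y /andP[yQ sy].
by rewrite !mulr1 hf.
Qed.

(* [ga] parametrises the range of integration: it lets [f \o ga] be Lipschitz where
   [f] is not, as for f(u) = sqrt (1 - u^2) at u = 1 with ga = sin.  [F_approx] says
   that F is a primitive of f(ga x) d(ga x)^be, with a quadratic error. *)
Variables (ga f F : R -> R) (x0 x1 L : R).
Hypothesis x01 : x0 <= x1.
Hypothesis ga_ge0 : 0 <= ga x0.
Hypothesis ga_mono : forall x y, x0 <= x -> x <= y -> y <= x1 -> ga x <= ga y.
Hypothesis f_lip : forall x y u, x0 <= x -> x <= y -> y <= x1 ->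
  ga x <= u -> u <= ga y -> `|f u - f (ga x)| <= L * (y - x).
Hypothesis F_approx : forall x y, x0 <= x -> x <= y -> y <= x1 ->
  `|F y - F x - f (ga x) * (ga y ^+ be - ga x ^+ be)| <= L * (y - x) ^+ 2.

Section fixed_mesh.
Variable K : nat.
Let d := (x1 - x0) / K.+1%:R.
Let pt k := x0 + k%:R * d.

Let d_ge0 : 0 <= d. Proof. by rewrite divr_ge0 // subr_ge0. Qed.
Let ptS k : pt k.+1 = pt k + d.
Proof. by rewrite /pt -addn1 natrD mulrDl mul1r addrA. Qed.
Let pt_ge k : x0 <= pt k.
Proof. by rewrite lerDl mulr_ge0. Qed.
Let pt0 : pt 0 = x0. Proof. by rewrite /pt mul0r addr0. Qed.
Let ptK : pt K.+1 = x1.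
Proof. by rewrite /pt mulrC divfK ?pnatr_eq0 // addrC subrK. Qed.
Let pt_mono k l : (k <= l)%N -> pt k <= pt l.
Proof. by move=> kl; rewrite lerD2l ler_wpM2r // ler_nat. Qed.
Let pt_le k : (k <= K.+1)%N -> pt k <= x1.
Proof. by move=> kK; rewrite -ptK pt_mono. Qed.
Let ga_pt k l : (k <= l)%N -> (l <= K.+1)%N -> ga (pt k) <= ga (pt l).
Proof. by move=> kl lK; apply: ga_mono => //; [exact: pt_mono|exact: pt_le]. Qed.
Let ga_pt0 k : (k <= K.+1)%N -> 0 <= ga (pt k).
Proof. by move=> kK; apply: le_trans ga_ge0 _; rewrite -pt0 ga_pt. Qed.

Let S T k := \sum_(y <- Q (ga (pt k) * T) | ga x0 * T < pos y) f (pos y / T).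
Let q T k : R := #|` Q (ga (pt k) * T)|%:R.

Let sum_split T k : 0 <= T -> (k < K.+1)%N ->
  S T k.+1 = S T k +
   \sum_(y <- Q (ga (pt k.+1) * T) | ga (pt k) * T < pos y) f (pos y / T).
Proof.
move=> T0 kK; rewrite /S.
have le1 : ga x0 * T <= ga (pt k) * T.
  by rewrite ler_wpM2r // -pt0 ga_pt // ltnW.
have le2 : ga (pt k) * T <= ga (pt k.+1) * T by rewrite ler_wpM2r // ga_pt.
rewrite (bigID (fun y => ga (pt k) * T < pos y)) /= addrC; congr (_ + _).
  rewrite -big_filter -[RHS]big_filter; apply: perm_big; apply: uniq_perm.
  - by rewrite filter_uniq // fset_uniq.
  - by rewrite filter_uniq // fset_uniq.
  by move=> y; rewrite !mem_filter -leNgt (QE le2) andbAC andbA.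
apply: eq_bigl => y.
by rewrite andb_idl //; apply: le_lt_trans.
Qed.

Let slab T k : 0 < T -> (k < K.+1)%N ->
  `|\sum_(y <- Q (ga (pt k.+1) * T) | ga (pt k) * T < pos y) f (pos y / T) -
     f (ga (pt k)) * (q T k.+1 - q T k)| <= L * d * (q T k.+1 - q T k).
Proof.
move=> T0 kK; apply: slab_approx.
  by apply: ler_wpM2r; [exact: ltW|exact: ga_pt].
move=> y; rewrite (QE (lexx _)) => /andP[_ y2] y1.
have := @f_lip (pt k) (pt k.+1) (pos y / T).
rewrite [pt k.+1 - _](_ : _ = d); last by rewrite ptS addrC addKr.
apply; rewrite ?pt_mono ?pt_le //.
  by rewrite ler_pdivlMr // ltW.
by rewrite ler_pdivrMr.
Qed.

Lemma riemann_count_mesh T : 0 < T ->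
  `|\sum_(y <- Q (ga x1 * T) | ga x0 * T < pos y) f (pos y / T) -
    \sum_(k < K.+1) f (ga (pt k)) * (q T k.+1 - q T k)|
  <= L * d * q T K.+1.
Proof.
move=> T0; rewrite -[x1 in ga x1]ptK -/(S T K.+1).
(* The sign is extracted from [f_lip] on the first cell, with u at its left endpoint, where the
   left-hand side vanishes. *)
have L0 : 0 <= L * d.
  have := @f_lip (pt 0) (pt 1) (ga (pt 0)).
  rewrite subrr normr0 ptS [pt 0 + d]addrC addrK; apply => //.
  - by rewrite addrC -ptS pt_mono.
  - by rewrite addrC -ptS pt_le.
  by rewrite addrC -ptS ga_pt.
suff h n : (n <= K.+1)%N ->
    `|S T n - \sum_(k < n) f (ga (pt k)) * (q T k.+1 - q T k)|
      <= L * d * (q T n - q T 0).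
  apply: le_trans (h _ (leqnn _)) _; rewrite ler_wpM2l // lerBlDr lerDl.
  exact: ler0n.
elim: n => [_|n IH nK].
  rewrite big_ord0 subrr mulr0 subr0 /S pt0 big1_seq ?normr0 // => y /andP[h].
  by rewrite (QE (lexx _)) leNgt h andbF.
rewrite big_ord_recr /= (sum_split (ltW T0) nK).
rewrite opprD addrACA; apply: le_trans (ler_normD _ _) _.
have := lerD (IH (ltnW nK)) (slab T0 nK); congr (_ <= _); ring.
Qed.

Lemma riemann_mesh :
  `|F x1 - F x0 -
    \sum_(k < K.+1) f (ga (pt k)) * (ga (pt k.+1) ^+ be - ga (pt k) ^+ be)|
  <= L * (x1 - x0) * d.
Proof.
have -> : L * (x1 - x0) * d = \sum_(k < K.+1) L * d ^+ 2.
  rewrite sumr_const card_ord -[RHS]mulr_natr /d.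
  have : K.+1%:R != 0 :> R by rewrite pnatr_eq0.
  by move: K.+1%:R => k k0; field.
have -> : F x1 - F x0 = \sum_(k < K.+1) (F (pt k.+1) - F (pt k)).
  by rewrite -(big_mkord xpredT (fun k => F (pt k.+1) - F (pt k)))
     telescope_sumr // ptK pt0.
rewrite -sumrB; apply: le_trans (ler_norm_sum _ _ _) _.
apply: ler_sum => k _.
have := @F_approx (pt k) (pt k.+1).
rewrite [pt k.+1 - _](_ : _ = d); last by rewrite ptS addrC addKr.
by apply; rewrite ?pt_mono ?pt_le.
Qed.

Lemma cvg_riemann_mesh :
  (\sum_(k < K.+1) f (ga (pt k)) * (q T k.+1 - q T k)) / T ^+ be @[T --> +oo]
  --> B * \sum_(k < K.+1)
        f (ga (pt k)) * (ga (pt k.+1) ^+ be - ga (pt k) ^+ be).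
Proof.
under eq_fun do rewrite mulr_suml; rewrite mulr_sumr.
apply: cvg_sumr => k _.
rewrite mulrCA; under eq_fun do rewrite -mulrA.
apply: cvgMr; rewrite mulrBr; under eq_fun do rewrite mulrBl.
by apply: cvgB; apply: cardQ; rewrite ga_pt0 // ltnW.
Qed.

Lemma cvg_card_top :
  q T K.+1 / T ^+ be @[T --> +oo] --> B * ga x1 ^+ be.
Proof. by rewrite /q ptK; apply: cardQ; rewrite -ptK ga_pt0. Qed.

End fixed_mesh.
Arguments cvg_riemann_mesh K : clear implicits.
Arguments cvg_card_top K : clear implicits.
Arguments riemann_mesh K : clear implicits.
Arguments riemann_count_mesh K [T].

(** A Riemann-Stieltjes sum with respect to the counting function of [Q]. On each slab f is replaced
    by its value at the left end, and the number of points of the slab is a difference of two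
    cardinalities, known asymptotically. The mesh is fixed first, then T grows; the remaining error
    is O(1/(K + 1)). *)
Lemma riemann_count :
  (\sum_(y <- Q (ga x1 * T) | ga x0 * T < pos y) f (pos y / T)) / T ^+ be
    @[T --> +oo] --> B * (F x1 - F x0).
Proof.
apply/cvg_pinftyP => e e0.
(* D/(K + 1) is the total mesh error. Its first summand is the Lipschitz error times a bound for the
   number of points over T^be; the second is the error of [riemann_mesh] times |B|. *)
pose D := `|L| * (x1 - x0) * (`|B * ga x1 ^+ be| + 1)
          + `|B| * (`|L| * (x1 - x0) * (x1 - x0)).
have D0 : 0 <= D by rewrite addr_ge0 ?mulr_ge0 ?subr_ge0 ?addr_ge0.
pose K := Num.bound (D / (e / 2)).
have KD : D / K.+1%:R <= e / 2.
  rewrite ler_pdivrMr ?ltr0n // mulrC -ler_pdivrMr ?divr_gt0 //.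
  apply: le_trans (ltW (archi_boundP _)) _.
    by rewrite divr_ge0 // divr_ge0 // ltW.
  by rewrite ler_nat.
have /cvg_pinftyP/(_ (e / 2)) := cvg_riemann_mesh K.
rewrite divr_gt0 // => /(_ isT)[M1 hM1].
have /cvg_pinftyP/(_ 1 ltr01)[M2 hM2] := cvg_card_top K.
exists (Num.max 1 (Num.max M1 M2)) => T.
rewrite !ge_max => /and3P[T1 /hM1 {hM1} + /hM2 {hM2}].
have T0 : 0 < T by apply: lt_le_trans T1.
have Tb : 0 < T ^+ be by rewrite exprn_gt0.
have := riemann_count_mesh K T0; have := riemann_mesh K.
set d := (x1 - x0) / _; set q := #|` _|%:R.
set S1 := \sum_(k < _) _; set S2 := \sum_(k < _) _; set S := \sum_(y <- _ | _) _.
move=> h1 h2 h3 h4.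
have q0 : 0 <= q / T ^+ be by rewrite divr_ge0 // ltW.
have {h4} h4 : q / T ^+ be <= `|B * ga x1 ^+ be| + 1.
  have := ler_norm (B * ga x1 ^+ be); move: h4; rewrite ler_norml => /andP[_].
  lra.
have d0 : 0 <= d by rewrite divr_ge0 // subr_ge0.
have {h2} h2 : `|S / T ^+ be - S2 / T ^+ be| <=
    `|L| * d * (`|B * ga x1 ^+ be| + 1).
  rewrite -mulrBl normrM normfV (gtr0_norm Tb) ler_pdivrMr //.
  apply: le_trans h2 _; apply: (@le_trans _ _ (`|L| * d * q)).
    by rewrite ler_wpM2r // ?ler_wpM2r ?ler_norm.
  rewrite -[leRHS]mulrA; apply: ler_wpM2l; first by rewrite mulr_ge0.
  by move: h4; rewrite ler_pdivrMr.
have {h1} h1 : `|B * S1 - B * (F x1 - F x0)| <= `|B| * (`|L| * (x1 - x0) * d).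
  rewrite -mulrBr normrM ler_wpM2l // distrC; apply: le_trans h1 _.
  by rewrite ler_wpM2r // ler_wpM2r ?subr_ge0 ?ler_norm.
have : `|L| * d * (`|B * ga x1 ^+ be| + 1) + `|B| * (`|L| * (x1 - x0) * d)
   <= e / 2.
  by apply: le_trans KD; rewrite le_eqVlt; apply/orP; left; apply/eqP;
     rewrite /D /d; ring.
move: h1 h2 h3; rewrite !ler_norml; lra.
Qed.

Variables (n : R -> R) (A : R) (al : nat) (phi : R -> R).
Hypothesis al_gt0 : (0 < al)%N.
Hypothesis nE : forall e : R, 0 < e -> exists C : R, forall t : R, 0 <= t ->
  `|n t - A * t ^+ al| <= e * t ^+ al + C.
Hypothesis phi_ge0 : forall u, ga x0 <= u -> u <= ga x1 -> 0 <= phi u.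
Hypothesis phiX : forall u, ga x0 <= u -> u <= ga x1 -> phi u ^+ al = f u.

(** With u = pos y / T, the inner count n(T phi(u)) is A T^al f(u) up to a small multiple of T^al
    and a constant. Summed over the O(T^be) outer points, the constant contributes O(T^be),
    negligible against T^(al + be) because al > 0. The lemma is used with al = be = 1 for the disc
    and al = be = 2 for pairs of Gaussian integers. *)
Lemma riemann_count_comp :
  (\sum_(y <- Q (ga x1 * T) | ga x0 * T < pos y) n (T * phi (pos y / T)))
    / T ^+ (al + be) @[T --> +oo] --> A * B * (F x1 - F x0).
Proof.
pose m := `|f (ga x0)| + `|L| * (x1 - x0).
have m0 : 0 <= m by rewrite addr_ge0 ?mulr_ge0 ?subr_ge0.
have fm u : ga x0 <= u -> u <= ga x1 -> f u <= m.
  move=> u0 u1; have := f_lip (lexx _) x01 (lexx _) u0 u1.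
  have := ler_norm (f (ga x0)).
  have : L * (x1 - x0) <= `|L| * (x1 - x0).
    by rewrite ler_wpM2r ?subr_ge0 // ler_norm.
  by rewrite /m ler_norml; lra.
pose b := `|B * ga x1 ^+ be| + 1.
have b0 : 0 < b by rewrite ltr_pwDr.
apply/cvg_pinftyP => e e0.
have m1 : 0 < m + 1 by rewrite ltr_pwDr.
(* As m bounds f = phi^al and b bounds the number of points over T^be, a relative error c in n costs
   at most c m b <= e/4. The added 1 avoids a division by zero. *)
pose c := e / 4 / (b * (m + 1)).
have c0 : 0 < c by rewrite /c !divr_gt0 // mulr_gt0.
have [C hC] := nE c0.
have /cvg_pinftyP/(_ (e / 2)) : A * ((\sum_(y <- Q (ga x1 * T) | ga x0 * T < pos y)
    f (pos y / T)) / T ^+ be) @[T --> +oo] --> A * (B * (F x1 - F x0)).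
  by apply: cvgMr; exact: riemann_count.
rewrite divr_gt0 // => /(_ isT)[M1 hM1].
have /cvg_pinftyP/(_ 1 ltr01)[M2 hM2] := cvg_card_top 0.
have /cvg_pinftyP/(_ (e / 4)) := cvg_invXn_pinfty (`|C| * b) al_gt0.
rewrite divr_gt0 // => /(_ isT)[M3 hM3].
exists (Num.max 1 (Num.max M1 (Num.max M2 M3))) => T.
rewrite !ge_max => /and4P[T1 /hM1 {hM1} + /hM2 {hM2} + /hM3 {hM3}].
have T0 : 0 < T by apply: lt_le_trans T1.
have Tb : 0 < T ^+ be by rewrite exprn_gt0.
have Ta : 0 < T ^+ al by rewrite exprn_gt0.
rewrite mul1r subr0.
have -> : x0 + (x1 - x0) / 1 = x1 by rewrite divr1 addrC subrK.
set S := \sum_(y <- _ | _) _; set q := #|` _|%:R; set N := \sum_(y <- _ | _) _.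
move=> h1 h2 h3.
have q0 : 0 <= q by [].
have {h2} h2 : q / T ^+ be <= b.
  have := ler_norm (B * ga x1 ^+ be); move: h2; rewrite ler_norml => /andP[_].
  by rewrite /b; lra.
have cm0 : 0 <= c * (T ^+ al * m) by rewrite (mulr_ge0 (ltW c0)) // mulr_ge0 // (ltW Ta).
have h4 : `|N - A * T ^+ al * S| <= (c * (T ^+ al * m) + `|C|) * q.
  rewrite mulr_sumr -sumrB; apply: le_trans (ler_norm_sum _ _ _) _.
  rewrite /q card_fset_sum1 natr_sum mulr_sumr.
  rewrite [leRHS](bigID (fun y => ga x0 * T < pos y)) /= -[leLHS]addr0.
  apply: lerD; last by apply: sumr_ge0 => y _; rewrite mulr1 addr_ge0.
  rewrite big_seq_cond [leRHS]big_seq_cond; apply: ler_sum => y /andP[yQ sy].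
  have u0 : ga x0 <= pos y / T by rewrite ler_pdivlMr // ltW.
  have u1 : pos y / T <= ga x1.
    by rewrite ler_pdivrMr //; move: yQ; rewrite (QE (lexx _)) => /andP[].
  have := hC (T * phi (pos y / T)).
  rewrite exprMn phiX // mulrA mulr1 => hh; apply: le_trans (hh _) _.
    by apply: mulr_ge0; [exact: ltW|exact: phi_ge0].
  apply: lerD (ler_norm _); apply: ler_wpM2l; first exact: ltW.
  by apply: ler_wpM2l; [exact: ltW|exact: fm].
have h5 : `|N / T ^+ (al + be) - A * (S / T ^+ be)| <= e / 4 + e / 4.
  have -> : N / T ^+ (al + be) - A * (S / T ^+ be) =
     (N - A * T ^+ al * S) / (T ^+ al * T ^+ be).
    by rewrite exprD; field; rewrite !gt_eqF.
  rewrite normrM normfV (gtr0_norm (mulr_gt0 Ta Tb)).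
  apply: (@le_trans _ _ ((c * (T ^+ al * m) + `|C|) * q / (T ^+ al * T ^+ be))).
    by rewrite ler_wpM2r // invr_ge0 ltW // mulr_gt0.
  have -> : (c * (T ^+ al * m) + `|C|) * q / (T ^+ al * T ^+ be) =
     e / 4 * (m / (m + 1)) * ((q / T ^+ be) / b) + `|C| * (q / T ^+ be) / T ^+ al.
    by rewrite /c; field; rewrite !gt_eqF.
  have q0' : 0 <= q / T ^+ be by rewrite divr_ge0 // ltW.
  have e4 : 0 <= e / 4 by rewrite divr_ge0 // ltW.
  have mm : 0 <= m / (m + 1) by rewrite divr_ge0 // ltW.
  apply: lerD.
    rewrite -[leRHS]mulr1; apply: ler_pM.
    - by rewrite mulr_ge0.
    - by rewrite divr_ge0 // ltW.
    - rewrite -[leRHS]mulr1; apply: ler_wpM2l => //.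
      by rewrite ler_pdivrMr // mul1r lerDl.
    - by rewrite ler_pdivrMr // mul1r.
  apply: le_trans h3; rewrite [leRHS]ger0_norm; last first.
    by apply: divr_ge0; [apply: mulr_ge0 => //|]; exact: ltW.
  by apply: ler_wpM2r; [rewrite invr_ge0 ltW|exact: ler_wpM2l].
move: h1 h5; rewrite mulrA !ler_norml; lra.
Qed.

End riemann_count.

(** * The Gauss circle problem *)

Lemma cvg_pinfty_perturb (R : realType) (f g : R -> R) (l C M : R) (k : nat) :
  (0 < k)%N -> f x @[x --> +oo] --> l ->
  (forall x, M <= x -> `|g x - f x| <= C / x ^+ k) ->
  g x @[x --> +oo] --> l.
Proof.
move=> k0 /cvg_pinftyP fl gf; apply/cvg_pinftyP => e e0.
have e2 : 0 < e / 2 by rewrite divr_gt0.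
have [M1 h1] := fl _ e2.
have /cvg_pinftyP/(_ _ e2)[M2 h2] := cvg_invXn_pinfty C k0.
exists (Num.max M (Num.max M1 M2)) => x.
rewrite !ge_max => /and3P[/gf + /h1 + /h2]; rewrite subr0.
have := ler_norm (C / x ^+ k); rewrite !ler_norml; lra.
Qed.

Lemma sum_fset_fiber (V : nmodType) (I J : choiceType) (A : {fset I})
  (Y : {fset J}) (P : pred I) (f : I -> J) (F : I -> V) :
  (forall a, a \in A -> P a -> f a \in Y) ->
  \sum_(a <- A | P a) F a = \sum_(y <- Y) \sum_(a <- A | P a && (f a == y)) F a.
Proof.
move=> fY; under [RHS]eq_bigr do rewrite big_mkcond.
rewrite exchange_big /= big_seq_cond [LHS]big_mkcond [RHS]big_seq.
rewrite [RHS]big_mkcond; apply: eq_bigr => a _; case: (boolP (a \in A)) => //= aA.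
case: (boolP (P a)) => Pa /=; last by rewrite big1_eq.
rewrite (bigD1_seq (f a)) ?fset_uniq ?fY //= eqxx big1 ?addr0 // => y.
by rewrite eq_sym => /negbTE ->.
Qed.

Lemma sum_fset_reindex (V : nmodType) (I J : choiceType) (A : {fset I})
  (P : pred I) (B : {fset J}) (f : J -> I) (F : I -> V) :
  {in B &, injective f} ->
  (forall a, reflect (exists2 b, b \in B & f b = a) ((a \in A) && P a)) ->
  \sum_(a <- A | P a) F a = \sum_(b <- B) F (f b).
Proof.
move=> finj fP; rewrite -big_filter -(big_map f xpredT).
apply: perm_big; apply: uniq_perm.
- by rewrite filter_uniq // fset_uniq.
- by rewrite map_inj_in_uniq // fset_uniq.
move=> a; rewrite mem_filter andbC; apply/fP/mapP => -[b bB ab]; by exists b.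
Qed.

Lemma natr_card_fset (R : pzSemiRingType) (I : choiceType) (A : {fset I}) :
  #|` A|%:R = \sum_(a <- A) 1 :> R.
Proof. by rewrite card_fset_sum1 natr_sum. Qed.

Section ball.
Variables (R : realType) (I : choiceType) (pos : I -> R).
Hypothesis pos_fin : forall t, finite_set [set y | pos y <= t].

Definition ball_in (D : set I) (t : R) : {fset I} :=
  fset_set (D `&` [set y | pos y <= t]).

Lemma in_ball_in D t y : (y \in ball_in D t) = (y \in D) && (pos y <= t).
Proof.
rewrite in_fset_set; last exact: finite_setIr.
by apply/idP/andP => [/set_mem[/mem_set]|[/set_mem Dy yt]] //; exact/mem_set.
Qed.

Lemma ball_in_sub D s t : s <= t ->
  forall y, (y \in ball_in D s) = (y \in ball_in D t) && (pos y <= s).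
Proof.
move=> st y; rewrite !in_ball_in -andbA; congr (_ && _).
by apply/idP/andP => [ys|[]//]; rewrite ys (le_trans ys st).
Qed.

Lemma card_ball_in_mono D s t : s <= t ->
  (#|` ball_in D s|%:R <= #|` ball_in D t|%:R :> R).
Proof.
move=> st; rewrite ler_nat fsubset_leq_card //; apply/fsubsetP => y.
by rewrite (ball_in_sub _ st) => /andP[].
Qed.

End ball.

(** Below the threshold of the limit, monotonicity bounds n by a constant, which is put into C. A
    bound for all t >= 0 is required because n is evaluated at T phi(u), which can stay small while
    T grows. *)
Lemma approx_of_cvg (R : realType) (n : R -> R) (A : R) (al : nat) :
  (forall s t, s <= t -> n s <= n t) -> (forall t, 0 <= n t) ->
  n t / t ^+ al @[t --> +oo] --> A ->
  forall e : R, 0 < e -> exists C : R, forall t : R, 0 <= t ->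
    `|n t - A * t ^+ al| <= e * t ^+ al + C.
Proof.
move=> nm n0 /cvg_pinftyP nA e e0; have [M hM] := nA e e0.
pose M' := Num.max 1 M; have M'1 : 1 <= M' by rewrite le_max lexx.
have M'0 : 0 < M' by apply: lt_le_trans M'1.
exists (n M' + `|A| * M' ^+ al) => t t0.
have C0 : 0 <= n M' + `|A| * M' ^+ al.
  by rewrite addr_ge0 // mulr_ge0 // exprn_ge0 // ltW.
have [tM|/ltW tM] := leP M' t.
  have tp : 0 < t by apply: lt_le_trans tM.
  have : M <= t by apply: le_trans tM; rewrite le_max lexx orbT.
  move=> /hM h; rewrite -[leLHS]addr0; apply: lerD => //.
  rewrite -ler_pdivrMr ?exprn_gt0 //; apply: le_trans h.
  rewrite -[leLHS](ger0_norm) ?divr_ge0 ?exprn_ge0 // normrM normr_id.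
  by rewrite -normrM mulrBl mulfK // gt_eqF // exprn_gt0.
apply: le_trans (ler_normB _ _) _; rewrite -[leLHS]add0r; apply: lerD.
  by rewrite mulr_ge0 ?exprn_ge0 // ltW.
rewrite ger0_norm // normrM [ `|t ^+ al|]ger0_norm ?exprn_ge0 //.
by apply: lerD; [exact: nm|rewrite ler_wpM2l // lerXn2r // nnegrE ltW].
Qed.

Section circle.
Variable R : realType.

Let absr (b : int) : R := `|b|%:~R.

Let absr_ge0 b : 0 <= absr b. Proof. by rewrite /absr ler0z. Qed.

Let absr_fin t : finite_set [set b | absr b <= t].
Proof.
pose n := Num.bound `|t|.
apply: (@sub_finite_set _ _ ((fun k : nat => k%:Z - n%:Z) @` `I_(n.*2.+1))).
  move=> b /= bt; have {bt} : absr b < n%:R.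
    apply: le_lt_trans bt _; apply: le_lt_trans (ler_norm _) _.
    by rewrite archi_boundP.
  rewrite /absr -[n%:R]/(n%:Z%:~R) ltr_int => bn.
  by exists (absz (b + n)); move: bn; rewrite /= ?normr_lt_n; lia.
by apply: finite_image; exact: finite_II.
Qed.

Let QZ := ball_in absr [set: int].

Let in_QZ t b : (b \in QZ t) = (absr b <= t).
Proof. by rewrite in_ball_in // in_setT. Qed.

Let card_QZ t : 0 <= t -> `|#|` QZ t|%:R - 2 * t| <= 1.
Proof.
move=> t0; have := floor_itv t.
have : 0 <= Num.floor t by rewrite floor_ge0.
case E : (Num.floor t) => [n|//] _ /andP[n1 n2].
have -> : #|` QZ t| = n.*2.+1.
  apply: card_fset_set; rewrite setTI.
  have -> : [set y | absr y <= t] = (fun k : nat => k%:Z - n%:Z) @` `I_(n.*2.+1).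
    apply/seteqP; split => [b|_ [k kn <-]] /=.
      rewrite /absr -floor_ge_int E => bn.
      by exists (absz (b + n)); move: bn => /=; lia.
    rewrite /absr -floor_ge_int E; move: kn => /=; lia.
  by apply: inj_card_eq => k l _ _ /= /addIr [].
move: n1 n2; rewrite rmorphD /= -[n%:~R]/(n%:R : R) -addn1 -muln2 natrD natrM.
by rewrite ler_norml; lra.
Qed.

Let card_QZ_lim s : 0 <= s ->
  (#|` QZ (s * T)|%:R / T ^+ 1) @[T --> +oo] --> 2 * s ^+ 1.
Proof.
move=> s0; apply/cvg_pinftyP => e e0; exists (Num.max 1 e^-1) => T.
rewrite ge_max => /andP[T1 Te]; have T0 : 0 < T by apply: lt_le_trans T1.
have := card_QZ (mulr_ge0 s0 (ltW T0)).
set q := #|` _|%:R => h.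
have -> : q / T ^+ 1 - 2 * s ^+ 1 = (q - 2 * (s * T)) / T.
  by field; rewrite gt_eqF.
rewrite normrM normfV (gtr0_norm T0) ler_pdivrMr //; apply: le_trans h _.
by rewrite mulrC -ler_pdivrMr // div1r.
Qed.

Let card_QZ_approx e : 0 < e -> exists C : R, forall t : R, 0 <= t ->
    `|#|` QZ t|%:R - 2 * t ^+ 1| <= e * t ^+ 1 + C.
Proof.
move=> e0; exists 1 => t t0; rewrite !expr1; apply: le_trans (card_QZ t0) _.
by rewrite lerDr mulr_ge0 // ltW.
Qed.

Let cos_lip (x y : R) : x <= y -> `|cos x - cos y| <= y - x.
Proof.
move=> xy; have [|c _ h] := @MVT_segment R cos (fun x => - sin x) x y xy.
  by apply: continuous_subspaceT => z; exact: continuous_cos.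
rewrite distrC h normrM normrN [ `|y - x|]ger0_norm ?subr_ge0 //.
rewrite -[leRHS]mul1r ler_wpM2r ?subr_ge0 //.
by rewrite ler_norml sin_geN1 sin_le1.
Qed.

Let sin_mono (x y : R) : 0 <= x -> x <= y -> y <= pi / 2 -> sin x <= sin y.
Proof.
move=> x0 xy y1; have [|c cxy h] := @MVT_segment R sin cos x y xy.
  by apply: continuous_subspaceT => z; exact: continuous_sin.
rewrite -subr_ge0 h mulr_ge0 ?subr_ge0 //; apply: cos_ge0_pihalf.
move: cxy; rewrite in_itv /= => /andP[c1 c2]; rewrite (le_trans c2 y1) andbT.
by rewrite (le_trans _ (le_trans x0 c1)) // oppr_le0 divr_ge0 // pi_ge0.
Qed.

Let cosE (x : R) : 0 <= x -> x <= pi / 2 -> Num.sqrt (1 - sin x ^+ 2) = cos x.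
Proof.
move=> x0 x1; rewrite -[1](cos2Dsin2 x) addrK sqrtr_sqr ger0_norm //.
apply: cos_ge0_pihalf; rewrite x1 andbT (le_trans _ x0) //.
by rewrite oppr_le0 divr_ge0 // pi_ge0.
Qed.

(** A primitive of cos^2, that is, of sqrt(1 - u^2) du under u = sin x. *)
Let F (x : R) : R := (sin x * cos x + x) / 2.

(** The mean value theorem is applied to F(z) - cos(x) sin(z) with x frozen. Its derivative cos z
    (cos z - cos x) is at most z - x in absolute value, which supplies the second factor y - x. *)
Let F_approx (x y : R) : 0 <= x -> x <= y -> y <= pi / 2 ->
  `|F y - F x - cos x * (sin y ^+ 1 - sin x ^+ 1)| <= 1 * (y - x) ^+ 2.
Proof.
move=> x0 xy y1.
have [||c cxy h] := @MVT_segment R (fun z => F z - cos x * sin z)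
    (fun z => cos z * (cos z - cos x)) x y xy.
- move=> z _; rewrite /F; apply: is_derive_eq.
  rewrite /GRing.scale /=.
  have := cos2Dsin2 z; set s := sin z; set c := cos z; set c' := cos x => h.
  have -> : c * (c - c') = 2^-1 * (c * c + c * c) - c' * c by field.
  rewrite !mulr0 add0r mulrN; congr (_ * _ - _).
  by rewrite -[1 in LHS]h; ring.
- apply: continuous_subspaceT => z; rewrite /F.
  apply: cvgB; last by apply: cvgMr; exact: continuous_sin.
  apply: cvgMl; apply: cvgD; last exact: cvg_id.
  by apply: cvgM; [exact: continuous_sin|exact: continuous_cos].
rewrite !expr1; have -> : F y - F x - cos x * (sin y - sin x) =
  F y - cos x * sin y - (F x - cos x * sin x) by ring.
rewrite h mul1r expr2 !normrM [ `|y - x|]ger0_norm ?subr_ge0 //.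
rewrite ler_wpM2r ?subr_ge0 //; move: cxy; rewrite in_itv /= => /andP[c1 c2].
apply: (@le_trans _ _ (1 * (c - x))); last by rewrite mul1r lerD2r.
apply: ler_pM => //; first by rewrite ler_norml cos_geN1 cos_le1.
by rewrite distrC cos_lip.
Qed.

(** One factor 2 is the length of a row relative to its half-length, the other counts the rows b and
    -b; the quarter disc has area F(pi/2) - F(0) = pi/4. The row b = 0 is left out, as the Riemann
    sum starts strictly above its lower end. *)
Let row_sum_lim :
  (\sum_(b <- QZ T | 0 < absr b)
    #|` QZ (T * Num.sqrt (1 - (absr b / T) ^+ 2))|%:R) / T ^+ 2 @[T --> +oo]
  --> (pi : R).
Proof.
have -> : (pi : R) = 2 * 2 * (F (pi / 2) - F 0).
  by rewrite /F sin_pihalf cos_pihalf sin0 cos0; field.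
have pi2 : (0 : R) <= pi / 2 by rewrite divr_ge0 // pi_ge0.
have := @riemann_count_comp R int absr QZ (ball_in_sub absr_fin setT) 2 1
  card_QZ_lim sin (fun u => Num.sqrt (1 - u ^+ 2)) F 0 (pi / 2) 1 pi2.
rewrite sin0 sin_pihalf => /(_ (lexx _) sin_mono) h.
have := h _ _ (fun t => #|` QZ t|%:R) 2 1%N (fun u => Num.sqrt (1 - u ^+ 2)).
under eq_fun do rewrite mul0r mul1r; apply => //.
- move=> x y u x0 xy y1 u0 u1; rewrite mul1r.
  have sx0 : 0 <= sin x by rewrite -[X in X <= _]sin0 sin_mono // (le_trans xy).
  have cosx := cosE x0 (le_trans xy y1).
  have cosy := cosE (le_trans x0 xy) y1.
  have h1 : Num.sqrt (1 - u ^+ 2) <= cos x.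
    rewrite -cosx ler_wsqrtr // lerD2l lerN2 lerXn2r // nnegrE.
    exact: le_trans u0.
  have h2 : cos y <= Num.sqrt (1 - u ^+ 2).
    rewrite -cosy ler_wsqrtr // lerD2l lerN2 lerXn2r // nnegrE.
      exact: le_trans u0.
    exact: le_trans (le_trans sx0 u0) u1.
  have := cos_lip xy; rewrite cosx !ler_norml; lra.
- by move=> x y x0 xy y1; rewrite cosE ?F_approx // (le_trans xy).
Qed.

Let gball : R -> {fset gaussInt} := ball_in (@gabs R) [set: gaussInt].

Lemma gabs_sqr x : @gabs R x ^+ 2 = (gnorm x)%:~R.
Proof.
by rewrite /gabs /= sqr_sqrtr ?addr_ge0 ?sqr_ge0 // /gnorm rmorphD !rmorphXn.
Qed.

Lemma gabs_ge0 x : 0 <= @gabs R x.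
Proof. exact: sqrtr_ge0. Qed.

Lemma gabs_le x t : 0 <= t -> (@gabs R x <= t) = ((gnorm x)%:~R <= t ^+ 2).
Proof. by move=> t0; rewrite -gabs_sqr ler_pXn2r // nnegrE gabs_ge0. Qed.

Lemma finite_gabs_le t : finite_set [set x | @gabs R x <= t].
Proof.
apply: (@sub_finite_set _ _ ((fun p : int * int => GaussInt p.1 p.2) @`
   ([set b | absr b <= t] `*` [set b | absr b <= t]))); last first.
  by apply: finite_image; apply: finite_setX; exact: absr_fin.
move=> x /= xt; have t0 : 0 <= t by apply: le_trans xt; exact: gabs_ge0.
move: xt; rewrite gabs_le // /gnorm rmorphD !rmorphXn /= => xt.
have h (b : int) : b%:~R ^+ 2 <= t ^+ 2 -> absr b <= t.
  by rewrite /absr intr_norm -real_normK ?num_real // ler_pXn2r ?nnegrE.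
exists (gre x, gim x); last exact: gaussInt_eqP.
by split; apply: h; apply: le_trans xt; rewrite ?lerDl ?lerDr sqr_ge0.
Qed.

Let in_gball t x : (x \in gball t) = (@gabs R x <= t).
Proof. by rewrite in_ball_in ?in_setT //; exact: finite_gabs_le. Qed.

Let row T b : 0 < T -> absr b <= T ->
  (\sum_(x <- gball T | gim x == b) 1 : R) =
   #|` QZ (T * Num.sqrt (1 - (absr b / T) ^+ 2))|%:R.
Proof.
move=> T0 bT; rewrite natr_card_fset.
rewrite (@sum_fset_reindex _ _ _ _ _
   (QZ (T * Num.sqrt (1 - (absr b / T) ^+ 2))) (fun a => GaussInt a b)) //.
  by move=> a c _ _ [].
have b2 : absr b ^+ 2 = b%:~R ^+ 2.
  by rewrite /absr intr_norm real_normK ?num_real.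
have rE (a : int) : (absr a <= T * Num.sqrt (1 - (absr b / T) ^+ 2)) =
    (@gabs R (GaussInt a b) <= T).
  have h0 : 0 <= 1 - (absr b / T) ^+ 2.
    by rewrite subr_ge0 expr_le1 // ?ler_pdivrMr ?mul1r // divr_ge0 // ltW.
  rewrite (gabs_le _ (ltW T0)) -(@ler_pXn2r _ 2) ?nnegrE //; last first.
    by rewrite mulr_ge0 ?sqrtr_ge0 // ltW.
  rewrite exprMn sqr_sqrtr // expr_div_n mulrBr mulr1 [T ^+ 2 * _]mulrC.
  rewrite divfK; last by rewrite expf_eq0 /= gt_eqF.
  rewrite /absr !intr_norm !real_normK ?num_real // lerBrDr.
  by rewrite /gnorm rmorphD !rmorphXn.
move=> x; apply: (iffP andP) => [[xB /eqP xb]|[a aB <-]].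
  exists (gre x); last by rewrite -xb; exact: gaussInt_eqP.
  by rewrite in_QZ rE -in_gball -xb; case: (x) xB.
by split => //; rewrite in_gball -rE -in_QZ.
Qed.

Lemma gauss_circle :
  #|` ball_in (@gabs R) [set: gaussInt] T|%:R / T ^+ 2 @[T --> +oo] --> (pi : R).
Proof.
(* The missing row b = 0 has at most 2T + 1 <= 3T points for T >= 1, hence an error of at most 3/T
   after division by T^2. *)
rewrite -/gball; apply: (@cvg_pinfty_perturb _ _ _ _ 3 1 1 _ row_sum_lim) => // T T1.
have T0 : 0 < T by apply: lt_le_trans T1.
have T2 : 0 < T ^+ 2 by rewrite exprn_gt0.
have -> : #|` gball T|%:R = \sum_(b <- QZ T | 0 < absr b)
    #|` QZ (T * Num.sqrt (1 - (absr b / T) ^+ 2))|%:R + #|` QZ T|%:R :> R.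
  rewrite natr_card_fset (@sum_fset_fiber _ _ _ _ (QZ T) xpredT gim) /=; last first.
    move=> x + _; rewrite in_gball in_QZ (gabs_le _ (ltW T0)) => xT.
    rewrite -(@ler_pXn2r _ 2) ?nnegrE ?(ltW T0) //.
    rewrite /absr intr_norm real_normK ?num_real //; apply: le_trans xT.
    by rewrite /gnorm rmorphD !rmorphXn /= lerDr sqr_ge0.
  rewrite (bigID (fun b => 0 < absr b)) /=; congr (_ + _).
    rewrite big_seq_cond [RHS]big_seq_cond; apply: eq_bigr => b /andP[bQ _].
    by rewrite row // -in_QZ.
  have a0 : absr 0 = 0 by rewrite /absr normr0.
  have apos b : b != 0 -> 0 < absr b.
    by move=> b0; rewrite lt_neqAle absr_ge0 andbT eq_sym intr_eq0 normr_eq0.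
  rewrite big_mkcond (bigD1_seq 0) ?fset_uniq /=; last 2 first.
  - by rewrite in_QZ a0 ltW.
  - by [].
  rewrite [X in _ + X]big1 ?addr0; last by move=> b b0; rewrite apos.
  rewrite a0 ltxx /= row ?a0 //; last exact: ltW.
  by rewrite mul0r expr0n /= subr0 sqrtr1 mulr1.
have := card_QZ (ltW T0); set S := \sum_(_ <- _ | _) _; set q := #|` _|%:R.
have -> : (S + q) / T ^+ 2 - S / T ^+ 2 = q / T ^+ 2 by ring.
rewrite ler_norml => /andP[_ h].
rewrite ger0_norm ?divr_ge0 ?(ltW T2) // ler_pdivrMr // expr1.
rewrite expr2 mulrA divfK ?gt_eqF //; lra.
Qed.

End circle.

(** * Counting multiples in the region |f| |h|^3 <= T^4 *)

Lemma cvg_pinfty_scale (R : realType) (f : R -> R) (l c : R) (k : nat) :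
  0 < c -> f x / x ^+ k @[x --> +oo] --> l ->
  f (c * x) / x ^+ k @[x --> +oo] --> l * c ^+ k.
Proof.
move=> c0 /cvg_pinftyP fl; apply/cvg_pinftyP => e e0.
have ck : 0 < c ^+ k by rewrite exprn_gt0.
have [M hM] := fl (e / c ^+ k) (divr_gt0 e0 ck).
exists (Num.max 1 (M / c)) => x; rewrite ge_max => /andP[x1].
rewrite ler_pdivrMr // mulrC => /hM.
have x0 : 0 < x ^+ k by rewrite exprn_gt0 // (lt_le_trans _ x1).
rewrite ler_pdivlMr // -[c ^+ k in X in X -> _](gtr0_norm ck) -normrM mulrBl.
by rewrite exprMn; congr (`|_ - _| <= _); field; rewrite !gt_eqF.
Qed.

Section multiples.
Variable R : realType.
Local Notation gabs := (@gabs R).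
Implicit Types d e f h x : gaussInt.

Definition gball d (t : R) : {fset gaussInt} := ball_in gabs (principal d) t.

Definition dvdb d f : bool := `[< gdvd d f >].

Lemma in_gball d t x : (x \in gball d t) = dvdb d x && (gabs x <= t).
Proof.
rewrite in_ball_in; last exact: finite_gabs_le.
by congr (_ && _); apply/idP/asboolP => [/set_mem|] // ?; exact/mem_set.
Qed.

Lemma gabsM x y : gabs (x * y) = gabs x * gabs y.
Proof. by rewrite /Defs.gabs rmorphM ComplexField.Normc.normcM. Qed.

Lemma gabs_gt0 x : (0 < gabs x) = (x != 0).
Proof.
by rewrite lt_def gabs_ge0 andbT -sqrf_eq0 gabs_sqr intr_eq0 gnorm_eq0.
Qed.

Lemma gball_sub d s t : s <= t ->
  forall y, (y \in gball d s) = (y \in gball d t) && (gabs y <= s).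
Proof. by apply: ball_in_sub; exact: finite_gabs_le. Qed.

Lemma card_gball_sub d s t : s <= t ->
  #|` gball d s|%:R = \sum_(x <- gball d t | gabs x <= s) 1 :> R.
Proof.
move=> st; rewrite natr_card_fset; apply/esym/(sum_fset_reindex (f := id)) => // x.
rewrite -(gball_sub d st); apply: (iffP idP) => [xs|[y ys <-] //]; by exists x.
Qed.

Lemma card_gball d t : d != 0 -> #|` gball d t| = #|` gball 1 (t / gabs d)|.
Proof.
move=> d0; have ad : 0 < gabs d by rewrite gabs_gt0.
apply/eqP; rewrite -(eqr_nat R) !natr_card_fset; apply/eqP.
apply: (@sum_fset_reindex _ _ _ _ _ _ (fun x => x * d)) => [x y _ _|x].
  exact: mulIf.
rewrite in_gball andbT; apply: (iffP andP) => [[/asboolP[e ->]]|[y + <-]].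
  rewrite gabsM -ler_pdivlMr // => he; exists e => //.
  by rewrite in_gball he andbT; apply/asboolP; exists e; rewrite mulr1.
rewrite in_gball ler_pdivlMr // gabsM => /andP[_ ->]; split => //.
by apply/asboolP; exists y.
Qed.

Lemma gball1 t : gball 1 t = ball_in gabs [set: gaussInt] t.
Proof.
rewrite /gball; congr ball_in; apply/seteqP; split => // x _.
by exists x; rewrite mulr1.
Qed.

Lemma card_gball_lim d : d != 0 ->
  #|` gball d t|%:R / t ^+ 2 @[t --> +oo] --> pi / gabs d ^+ 2.
Proof.
move=> d0; under eq_fun do rewrite card_gball // gball1 [_ / gabs d]mulrC.
have d1 : 0 < (gabs d)^-1 by rewrite invr_gt0 gabs_gt0.
by have := cvg_pinfty_scale d1 (@gauss_circle R); rewrite exprVn.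
Qed.

Lemma card_gball_lim_scale d s : d != 0 -> 0 <= s ->
  #|` gball d (s * T)|%:R / T ^+ 2 @[T --> +oo] --> pi / gabs d ^+ 2 * s ^+ 2.
Proof.
move=> d0; rewrite le_eqVlt => /predU1P[<-|s0].
  by rewrite expr0n mulr0; under eq_fun do rewrite mul0r; exact: cvg_invXn_pinfty.
exact: cvg_pinfty_scale s0 (card_gball_lim d0).
Qed.

Lemma card_gball_approx d : d != 0 ->
  forall e : R, 0 < e -> exists C : R, forall t : R, 0 <= t ->
    `|#|` gball d t|%:R - pi / gabs d ^+ 2 * t ^+ 2| <= e * t ^+ 2 + C.
Proof.
move=> d0; apply: approx_of_cvg => [s t st|//|]; last exact: card_gball_lim.
by apply: card_ball_in_mono => //; exact: finite_gabs_le.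
Qed.

(** The inequality a|h| <= |f| is not strict, so the disc to be removed from each fibre is open. *)
Definition open_count d (t : R) : R := \sum_(x <- gball d t | gabs x < t) 1.

(* |f|^2 is an integer, but it is enough that |f|^2 <= t^2 - 1 implies |f| < t. *)
Lemma open_count_approx d : d != 0 ->
  forall e : R, 0 < e -> exists C : R, forall t : R, 0 <= t ->
    `|open_count d t - pi / gabs d ^+ 2 * t ^+ 2| <= e * t ^+ 2 + C.
Proof.
move=> d0 e e0; have := card_gball_approx d0 e0.
set A := pi / gabs d ^+ 2 => -[C hC].
have A0 : 0 <= A by rewrite divr_ge0 ?pi_ge0 ?sqr_ge0.
have C0 : 0 <= C.
  have := hC 0 (lexx _); rewrite expr0n !mulr0 add0r; exact: le_trans.
exists (C + A) => t t0.
have le1 : open_count d t <= #|` gball d t|%:R.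
  rewrite natr_card_fset [leRHS](bigID (fun x => gabs x < t)) /= lerDl.
  by rewrite sumr_ge0.
have := hC t t0; rewrite !ler_norml => /andP[_ h].
have [t1|t1] := leP 1 t; last first.
  have : 0 <= open_count d t by rewrite sumr_ge0.
  have : A * t ^+ 2 <= A by rewrite ler_piMr // expr_le1 // ltW.
  have : 0 <= e * t ^+ 2 by rewrite mulr_ge0 ?sqr_ge0 // ltW.
  by move=> *; apply/andP; split; lra.
have t2 : 0 <= t ^+ 2 - 1 by rewrite subr_ge0 expr_ge1.
have := hC (Num.sqrt (t ^+ 2 - 1)) (sqrtr_ge0 _).
rewrite sqr_sqrtr // ler_norml => /andP[h' _].
have : #|` gball d (Num.sqrt (t ^+ 2 - 1))|%:R <= open_count d t.
  have lt_sqrt : Num.sqrt (t ^+ 2 - 1) < t.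
    rewrite -[ltRHS]ger0_norm // -sqrtr_sqr ltr_sqrt; first by lra.
    by rewrite exprn_gt0 // (lt_le_trans _ t1).
  rewrite (card_gball_sub d (ltW lt_sqrt)) /open_count.
  rewrite big_mkcond [leRHS]big_mkcond; apply: ler_sum => x _.
  case: ifP => [xt|_]; last by case: ifP.
  by rewrite (le_lt_trans xt lt_sqrt).
by move=> *; apply/andP; split; lra.
Qed.

Variables (d e : gaussInt).
Hypotheses (d0 : d != 0) (e0 : e != 0).
Local Notation A := (pi / gabs d ^+ 2).
Local Notation B := (pi / gabs e ^+ 2).

(** This is the part where |f| is bounded linearly in |h|; c^2 u^4 / 2 is a primitive of c^2 u^2
    d(u^2). The count n is left abstract because closed discs (c = b) and open discs (c = a) both
    occur. *)
Lemma quad_piece (n : R -> R) (c s : R) : 0 <= c -> 0 <= s ->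
  (forall e : R, 0 < e -> exists C : R, forall t : R, 0 <= t ->
    `|n t - A * t ^+ 2| <= e * t ^+ 2 + C) ->
  (\sum_(h <- gball e (s * T) | 0 < gabs h) n (c * gabs h)) / T ^+ 4
    @[T --> +oo] --> A * B * (c ^+ 2 * s ^+ 4 / 2).
Proof.
move=> c0 s0 nA.
(* In the constant, 2 c^2 s is a Lipschitz bound for c^2 u^2 on [0, s], and 2 c^2 s^2 bounds the
   coefficient c^2 (y + x)^2 / 2 of the primitive error. *)
have := @riemann_count_comp R _ gabs (gball e) (gball_sub e) B 2
  (fun s => @card_gball_lim_scale e s e0) idfun (fun u => c ^+ 2 * u ^+ 2)
  (fun u => c ^+ 2 * u ^+ 4 / 2) 0 s (2 * c ^+ 2 * s + 2 * c ^+ 2 * s ^+ 2).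
move=> /(_ s0 (lexx _)) h.
have {h} := h _ _ _ n A 2 (fun u => c * u).
set L := 2 * c ^+ 2 * s + _.
have c2 : 0 <= c ^+ 2 by rewrite sqr_ge0.
have cs : 0 <= c ^+ 2 * s by rewrite mulr_ge0.
have cs2 : 0 <= c ^+ 2 * s ^+ 2 by rewrite mulr_ge0 ?sqr_ge0.
have -> : c ^+ 2 * s ^+ 4 / 2 - c ^+ 2 * 0 ^+ 4 / 2 = c ^+ 2 * s ^+ 4 / 2.
  by rewrite expr0n mulr0 mul0r subr0.
move=> h; have {h} := h _ _ _ isT nA.
rewrite /= => h; apply: cvg_trans (h _ _ _ _ _).
- apply: near_eq_cvg; exists 0; split => // T T0; congr (_ / _).
  by rewrite mul0r; apply: eq_bigr => y _; congr n; field; rewrite gt_eqF.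
- by [].
- move=> x y u x0 xy ys xu uy; have u0 := le_trans x0 xu.
  have -> : c ^+ 2 * u ^+ 2 - c ^+ 2 * x ^+ 2 = c ^+ 2 * (u + x) * (u - x) by ring.
  rewrite ger0_norm; last by rewrite mulr_ge0 ?subr_ge0 // mulr_ge0 // addr_ge0.
  apply: ler_pM.
  + by rewrite mulr_ge0 // addr_ge0.
  + by rewrite subr_ge0.
  + have : c ^+ 2 * (u + x) <= c ^+ 2 * (s + s) by apply: ler_wpM2l => //; lra.
    rewrite /L; lra.
  + by rewrite lerD2r.
- move=> x y x0 xy ys.
  have -> : c ^+ 2 * y ^+ 4 / 2 - c ^+ 2 * x ^+ 4 / 2 -
     c ^+ 2 * x ^+ 2 * (y ^+ 2 - x ^+ 2) =
     c ^+ 2 * ((y + x) ^+ 2) / 2 * (y - x) ^+ 2 by field.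
  have hx : (y + x) ^+ 2 <= (s + s) ^+ 2 by apply: lerXn2r; rewrite ?nnegrE; lra.
  rewrite ger0_norm; last first.
    by rewrite mulr_ge0 ?sqr_ge0 // divr_ge0 // mulr_ge0 ?sqr_ge0.
  rewrite ler_wpM2r ?sqr_ge0 // /L.
  have : c ^+ 2 * (y + x) ^+ 2 <= c ^+ 2 * (s + s) ^+ 2 by apply: ler_wpM2l.
  have -> : c ^+ 2 * (s + s) ^+ 2 = 4 * (c ^+ 2 * s ^+ 2) by ring.
  lra.
- by move=> u u0 us; rewrite mulr_ge0.
- by move=> u u0 us; rewrite exprMn.
Qed.

(** With u = |h|/T the radius is T^4/|h|^3 = T u^-3, and -u^-4 / 2 is a primitive of u^-6 d(u^2).
    The lower end s > 0 keeps u^-6 Lipschitz. *)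
Lemma cubic_piece (s r : R) : 0 < s -> s <= r ->
  (\sum_(h <- gball e (r * T) | s * T < gabs h)
     #|` gball d (T ^+ 4 / gabs h ^+ 3)|%:R) / T ^+ 4
    @[T --> +oo] --> A * B * ((s ^- 4 - r ^- 4) / 2).
Proof.
move=> s0 sr.
(* Here 6 s^-7 bounds the derivative of u^-6 on [s, r], and 6 s^-6 bounds the coefficient of (y -
   x)^2 in the primitive error. *)
have := @riemann_count_comp R _ gabs (gball e) (gball_sub e) B 2
  (fun s => @card_gball_lim_scale e s e0) idfun (fun u => u ^- 6)
  (fun u => - (u ^- 4 / 2)) s r (6 * s ^- 7 + 6 * s ^- 6) sr (ltW s0).
set L := 6 * s ^- 7 + _ => h.
have {h} := h _ _ _ (fun t => #|` gball d t|%:R) A 2 (fun u => u ^- 3).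
have -> : - (r ^- 4 / 2) - - (s ^- 4 / 2) = (s ^- 4 - r ^- 4) / 2 by ring.
move=> h; have {h} := h _ _ _ isT (card_gball_approx d0).
rewrite /= => h; apply: cvg_trans (h _ _ _ _ _).
- apply: near_eq_cvg; exists 0; split => // T T0; congr (_ / _).
  apply: eq_bigr => y hy; congr (#|` gball d _|%:R); field.
  by rewrite !gt_eqF //; apply: le_lt_trans hy; rewrite mulr_ge0 // ltW.
- by [].
- move=> x y u sx xy yr xu uy.
  have x0 : 0 < x by apply: lt_le_trans sx.
  have u0 : 0 < u by apply: lt_le_trans xu.
  have -> : u ^- 6 - x ^- 6 = - ((x^-1 ^+ 6 - u^-1 ^+ 6)) by rewrite !exprVn opprB.
  rewrite normrN.
  have vu : x^-1 - u^-1 <= s ^- 2 * (y - x).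
    have -> : x^-1 - u^-1 = (x^-1 * u^-1) * (u - x) by field; rewrite !gt_eqF.
    apply: ler_pM; rewrite ?mulr_ge0 ?invr_ge0 ?(ltW x0) ?(ltW u0) ?subr_ge0 //.
      rewrite expr2 invfM; apply: ler_pM; rewrite ?invr_ge0 ?(ltW x0) ?(ltW u0) //.
        by rewrite lef_pV2.
      by rewrite lef_pV2 // (le_trans sx).
    by rewrite lerD2r.
  have w0 : 0 <= u^-1 by rewrite invr_ge0 ltW.
  have wv : u^-1 <= x^-1 by rewrite lef_pV2.
  have vK : x^-1 <= s^-1 by rewrite lef_pV2.
  have yx : 0 <= y - x by rewrite subr_ge0.
  have K0 : 0 <= s ^- 6 by rewrite invr_ge0 exprn_ge0 // ltW.
  move: (x^-1) (u^-1) w0 wv vK vu => v w w0 wv vK vu.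
  have -> : v ^+ 6 - w ^+ 6 =
    (v ^+ 5 + v ^+ 4 * w + v ^+ 3 * w ^+ 2 + v ^+ 2 * w ^+ 3 + v * w ^+ 4 + w ^+ 5)
      * (v - w) by ring.
  have v0 : 0 <= v by apply: le_trans wv.
  have wK : w <= s^-1 by apply: le_trans vK.
  have pw (i j : nat) : v ^+ i * w ^+ j <= s^-1 ^+ (i + j).
    by rewrite exprD; apply: ler_pM; rewrite ?exprn_ge0 // lerXn2r // nnegrE // invr_ge0 ltW.
  rewrite ger0_norm; last first.
    by rewrite mulr_ge0 ?subr_ge0 // !addr_ge0 // ?mulr_ge0 // exprn_ge0.
  apply: (@le_trans _ _ (6 * s^-1 ^+ 5 * (s ^- 2 * (y - x)))).
    apply: ler_pM; rewrite ?subr_ge0 // ?addr_ge0 ?mulr_ge0 ?exprn_ge0 //.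
    have := pw 5 0; have := pw 4 1; have := pw 3 2; have := pw 2 3.
    have := pw 1 4; have := pw 0 5; rewrite /= !expr0 !expr1 !mulr1 !mul1r; lra.
  rewrite mulrA ler_wpM2r // /L -!exprVn -mulrA -exprD lerDl mulr_ge0 //.
  by rewrite exprVn.
- move=> x y sx xy yr.
  have x0 : 0 < x by apply: lt_le_trans sx.
  have y0 : 0 < y by apply: lt_le_trans xy.
  have -> : - (y ^- 4 / 2) - - (x ^- 4 / 2) - x ^- 6 * (y ^+ 2 - x ^+ 2) =
    - ((y + x) ^+ 2 * (2 * y ^+ 2 + x ^+ 2) / (2 * x ^+ 6 * y ^+ 4) * (y - x) ^+ 2).
    by field; rewrite !gt_eqF.
  have p0 : 0 <= 2 * y ^+ 2 + x ^+ 2.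
    by apply: addr_ge0; [apply: mulr_ge0 => //|]; exact: sqr_ge0.
  rewrite normrN ger0_norm; last first.
    apply: mulr_ge0; last exact: sqr_ge0.
    apply: divr_ge0; first by apply: mulr_ge0 => //; exact: sqr_ge0.
    by apply: mulr_ge0; [apply: mulr_ge0 => //|]; apply: exprn_ge0; exact: ltW.
  rewrite ler_wpM2r ?sqr_ge0 //; apply: (@le_trans _ _ (6 * x ^- 6)).
    rewrite ler_pdivrMr ?mulr_gt0 ?exprn_gt0 //.
    have -> : 6 * x ^- 6 * (2 * x ^+ 6 * y ^+ 4) = (y + y) ^+ 2 * (2 * y ^+ 2 + y ^+ 2).
      by field; rewrite gt_eqF.
    have xy2 : x ^+ 2 <= y ^+ 2 by rewrite lerXn2r // nnegrE ltW.
    apply: ler_pM; rewrite ?sqr_ge0 //.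
    + by rewrite lerXn2r ?nnegrE ?addr_ge0 ?(ltW x0) ?(ltW y0) // lerD2l.
    + by rewrite lerD2l.
  rewrite /L; have : x ^- 6 <= s ^- 6.
    by rewrite lef_pV2 ?posrE ?exprn_gt0 // lerXn2r // nnegrE ltW.
  have : 0 <= s ^- 7 by rewrite invr_ge0 exprn_ge0 // ltW.
  lra.
- move=> u su ur; rewrite invr_ge0 exprn_ge0 // ltW //; exact: lt_le_trans su.
- by move=> u su ur; rewrite -exprVn -exprM exprVn.
Qed.

End multiples.

(** * Assembling the region from its fibres over h *)

Section region.
Variables (R : realType) (a b : R).
Hypotheses (a0 : 0 < a) (ab : a <= b).
Local Notation gabs := (@gabs R).
Implicit Types (d e f h : gaussInt) (T : R).

Let b0 : 0 < b. Proof. exact: lt_le_trans ab. Qed.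

Definition region T : set (gaussInt * gaussInt) :=
  [set x | [/\ x.2 != 0, a * gabs x.2 <= gabs x.1, gabs x.1 <= b * gabs x.2 &
               gabs x.1 * gabs x.2 ^+ 3 <= T ^+ 4]].

Definition region_fset T : {fset gaussInt * gaussInt} := fset_set (region T).

(** This is c^(-1/4), the value of |h|/T at which the curves |f| = c|h| and |f| |h|^3 = T^4 meet. *)
Definition root4V (c : R) : R := (Num.sqrt (Num.sqrt c))^-1.

Lemma root4V_gt0 c : 0 < c -> 0 < root4V c.
Proof. by move=> c0; rewrite invr_gt0 !sqrtr_gt0. Qed.

Lemma root4VX c : 0 < c -> root4V c ^+ 4 = c^-1.
Proof.
by move=> c0; rewrite exprVn (exprM _ 2 2) sqr_sqrtr ?sqrtr_ge0 // sqr_sqrtr // ltW.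
Qed.

Lemma le_root4V c r T : 0 < c -> 0 <= r -> 0 <= T ->
  (r <= root4V c * T) = (c * r ^+ 4 <= T ^+ 4).
Proof.
move=> c0 r0 T0; have rc := root4V_gt0 c0.
rewrite -[LHS](@ler_pXn2r _ 4) ?nnegrE ?mulr_ge0 ?(ltW rc) //.
by rewrite exprMn root4VX // mulrC ler_pdivlMr // mulrC.
Qed.

Let sa := root4V a.
Let sb := root4V b.

Lemma region_bound T x : 0 <= T -> region T x ->
  gabs x.2 <= root4V a * T /\ gabs x.1 <= b * (root4V a * T).
Proof.
move=> T0 [_ h1 h2 h3]; have hb : gabs x.2 <= root4V a * T.
  rewrite le_root4V ?gabs_ge0 //; apply: le_trans h3.
  by rewrite exprS mulrA ler_wpM2r // exprn_ge0 // gabs_ge0.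
by split=> //; apply: le_trans h2 _; rewrite ler_wpM2l // ltW.
Qed.

Lemma finite_region T : 0 <= T -> finite_set (region T).
Proof.
move=> T0; apply: (@sub_finite_set _ _ ([set f | gabs f <= b * (root4V a * T)] `*`
    [set f | gabs f <= root4V a * T])).
  by move=> x /(region_bound T0)[].
by apply: finite_setX; exact: finite_gabs_le.
Qed.

Lemma in_region T x : 0 <= T -> (x \in region_fset T) = (x \in region T).
Proof. by move=> T0; rewrite in_fset_set //; exact: finite_region. Qed.

Section count.
Variables d e : gaussInt.
Hypotheses (d0 : d != 0) (e0 : e != 0).

(* |f| <= k T h combines |f| <= b |h| and |f| |h|^3 <= T^4: the first is the stronger
   one when b |h|^4 <= T^4. *)
Let k T h := if gabs h <= sb * T then b * gabs h else T ^+ 4 / gabs h ^+ 3.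

Let leP_k T h (r : R) : 0 < T -> 0 < gabs h -> 0 <= r ->
  (r <= k T h) = (r <= b * gabs h) && (r * gabs h ^+ 3 <= T ^+ 4).
Proof.
move=> T0 h0 r0; rewrite /k le_root4V ?(ltW h0) ?(ltW T0) //.
have h3 : 0 < gabs h ^+ 3 by rewrite exprn_gt0.
case: ifP => [hb|/negbT]; last rewrite -ltNge => /ltW hb.
  rewrite andb_idr // => rb; apply: le_trans hb.
  by rewrite (exprS _ 3) mulrA ler_wpM2r // ltW.
rewrite ler_pdivlMr // andbC andb_idr // => rb.
rewrite -(ler_pM2r h3); apply: le_trans rb _; apply: le_trans hb _.
by rewrite -mulrA -exprS.
Qed.

(** For fixed h, f runs over a closed disc of radius [k T h] deprived of the open disc of radius
    a|h|. The discs are nested because |h| <= a^(-1/4) T. *)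
Let fiber T h : 0 < T -> h \in gball e (sa * T) ->
  (\sum_(x <- region_fset T | (dvdb d x.1 && dvdb e x.2) && (x.2 == h)) 1 : R) =
  if 0 < gabs h then #|` gball d (k T h)|%:R - open_count d (a * gabs h) else 0.
Proof.
move=> T0; rewrite in_gball => /andP[eh hT].
case: ifP => h0; last first.
  rewrite big_seq_cond big1 // => x /andP[].
  rewrite in_region ?ltW // => /set_mem[x0 _ _ _] /andP[_ /eqP xh].
  by move: h0; rewrite gabs_gt0 -xh x0.
have ak : a * gabs h <= k T h.
  rewrite leP_k ?mulr_ge0 ?gabs_ge0 ?(ltW a0) // ler_pM2r // ab /=.
  by rewrite -mulrA -exprS -le_root4V ?gabs_ge0 // ltW.
have -> : open_count d (a * gabs h) = \sum_(f <- gball d (k T h) | gabs f < a * gabs h) 1 :> R.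
  rewrite /open_count -[RHS]big_filter -[LHS]big_filter.
  apply: perm_big; apply: uniq_perm; rewrite ?filter_uniq ?fset_uniq //.
  move=> f; rewrite !mem_filter; case: ltP => //= fh.
  by rewrite (gball_sub d ak) (ltW fh) andbT.
rewrite natr_card_fset [X in _ = X - _](bigID (fun f => gabs f < a * gabs h)) /=.
rewrite addrAC subrr add0r -[RHS]big_filter.
pose B := [fset f in gball d (k T h) | ~~ (gabs f < a * gabs h)]%fset.
rewrite (@sum_fset_reindex _ _ _ _ _ B (fun f => (f, h))); last 2 first.
- by move=> f g _ _ [].
- move=> x; rewrite in_region ?ltW //; apply: (iffP andP).
    move=> [/set_mem[x0 h1 h2 h3] /andP[/andP[dx _] /eqP xh]]; exists x.1.
      rewrite !inE /= in_gball dx -leNgt -xh h1 andbT /=.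
      by rewrite leP_k ?gabs_ge0 ?gabs_gt0 // h2 h3.
    by rewrite -xh; case: (x).
  move=> [f]; rewrite !inE /= in_gball -leNgt => /andP[/andP[df fk] hf] <-.
  rewrite df eh eqxx; split => //; apply/mem_set.
  by move: fk; rewrite leP_k ?gabs_ge0 // => /andP[h1 h2]; split; rewrite // -(@gabs_gt0 R).
apply: perm_big; apply: uniq_perm; rewrite ?filter_uniq ?fset_uniq //.
by move=> f; rewrite mem_filter !inE /= andbC.
Qed.


Let count_split T : 0 < T ->
  (\sum_(x <- region_fset T | dvdb d x.1 && dvdb e x.2) 1 : R) =
  \sum_(h <- gball e (sb * T) | 0 < gabs h) #|` gball d (b * gabs h)|%:R
  + \sum_(h <- gball e (sa * T) | sb * T < gabs h)
      #|` gball d (T ^+ 4 / gabs h ^+ 3)|%:R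
  - \sum_(h <- gball e (sa * T) | 0 < gabs h) open_count d (a * gabs h).
Proof.
move=> T0; have T1 := ltW T0.
have sba : sb * T <= sa * T.
  rewrite le_root4V // ?mulr_ge0 ?(ltW (root4V_gt0 b0)) //.
  rewrite exprMn root4VX // mulrA -[leRHS]mul1r ler_wpM2r ?exprn_ge0 //.
  by rewrite ler_pdivrMr // mul1r.
rewrite (@sum_fset_fiber _ _ _ _ (gball e (sa * T)) _ snd); last first.
  move=> x; rewrite in_region // => /set_mem /(region_bound T1)[h1 _] /andP[_ h2].
  by rewrite in_gball h2 h1.
rewrite big_seq; under eq_bigr do rewrite fiber //; rewrite -big_seq.
rewrite -big_mkcond sumrB; congr (_ - _).
rewrite (bigID (fun h => gabs h <= sb * T)) /=; congr (_ + _).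
  transitivity (\sum_(h <- gball e (sb * T) | 0 < gabs h)
      #|` gball d (k T h)|%:R : R).
    rewrite -big_filter -[RHS]big_filter; apply: perm_big.
    apply: uniq_perm; rewrite ?filter_uniq ?fset_uniq // => h.
    by rewrite !mem_filter (gball_sub e sba) andbAC -andbA.
  rewrite big_seq_cond [RHS]big_seq_cond; apply: eq_bigr => h /andP[].
  by rewrite in_gball /k => /andP[_ ->].
rewrite big_mkcond [RHS]big_mkcond; apply: eq_bigr => h _; rewrite -ltNge.
rewrite andbC andb_idr; last first.
  by apply: le_lt_trans; rewrite mulr_ge0 // ltW // root4V_gt0.
by case: ifP => // hT; rewrite /k leNgt hT.
Qed.

(** Since sa^4 = 1/a and sb^4 = 1/b, the three sums of [count_split] contribute b/2, (b - a)/2 and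
    -a/2, up to the common factor pi^2 / (N(d) N(e)). They add up to b - a. *)
Lemma region_count_dvd :
  ((\sum_(x <- region_fset T | dvdb d x.1 && dvdb e x.2) 1 : R) / T ^+ 4 : R)
    @[T --> +oo] --> (pi : R) ^+ 2 * (b - a) / (gabs d ^+ 2 * gabs e ^+ 2).
Proof.
have sa0 : 0 < sa by exact: root4V_gt0.
have sb0 : 0 < sb by exact: root4V_gt0.
have sba : sb <= sa.
  by rewrite lef_pV2 ?posrE ?sqrtr_gt0 // !ler_wsqrtr.
have h1 := quad_piece e0 (ltW b0) (ltW sb0) (@card_gball_approx R d d0).
have h2 := cubic_piece d0 e0 sb0 sba.
have h3 := quad_piece e0 (ltW a0) (ltW sa0) (@open_count_approx R d d0).
have -> : pi ^+ 2 * (b - a) / (gabs d ^+ 2 * gabs e ^+ 2) =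
  pi / gabs d ^+ 2 * (pi / gabs e ^+ 2) * (b ^+ 2 * sb ^+ 4 / 2) +
  pi / gabs d ^+ 2 * (pi / gabs e ^+ 2) * ((sb ^- 4 - sa ^- 4) / 2) -
  pi / gabs d ^+ 2 * (pi / gabs e ^+ 2) * (a ^+ 2 * sa ^+ 4 / 2).
  rewrite !root4VX // !invrK; field.
  by rewrite !gt_eqF // gabs_gt0.
apply/cvg_pinftyP => eps eps0.
have [M hM] := proj1 (@cvg_pinftyP R _ _) (cvgB (cvgD h1 h2) h3) eps eps0.
exists (Num.max 1 M) => T; rewrite ge_max => /andP[T1 /hM].
by rewrite (count_split (lt_le_trans ltr01 T1)) [in X in _ -> X]mulrDl
  [in X in _ -> X]mulrDl [in X in _ -> X]mulNr.
Qed.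

End count.
End region.

(** * Sieving by finitely many primes *)

Section sieve.
Variables (R : realType) (a b : R).
Hypotheses (a0 : 0 < a) (ab : a <= b).
Local Notation gabs := (@gabs R).
Implicit Types (d e f g h pi rho : gaussInt) (T : R).

Lemma dvdbP d f : reflect (gdvd d f) (dvdb d f).
Proof. exact: asboolP. Qed.

Lemma dvd1b f : dvdb 1 f.
Proof. by apply/dvdbP; exists f; rewrite mulr1. Qed.

Lemma gprime_pow_dvd pi d i f : gprime pi -> ~~ dvdb pi d ->
  gdvd (pi ^+ i) (f * d) -> gdvd (pi ^+ i) f.
Proof.
move=> [pi0 _ piP] nd; elim: i f => [f _|i IH f h].
  by rewrite expr0; exists f; rewrite mulr1.
have [|v fE] := IH f; first by apply: gdvd_trans h; exists pi; rewrite exprS.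
move: h => [w h].
have {}h : v * d = w * pi.
  by apply: (mulIf (expf_neq0 i pi0)); rewrite mulrAC -fE h exprS mulrA.
have [|[u uE]|/dvdbP hd] := piP v d; first by exists w.
  by exists u; rewrite fE uE exprS mulrA.
by rewrite hd in nd.
Qed.

(** A condition at pi is absorbed into the modulus already accumulated, so each term of the
    inclusion-exclusion is again a pair of divisibility conditions. *)
Lemma dvdb_mul_pow pi d i f : gprime pi -> ~~ dvdb pi d ->
  dvdb (d * pi ^+ i) f = dvdb d f && dvdb (pi ^+ i) f.
Proof.
move=> pip nd; apply/dvdbP/andP => [[w ->]|[/dvdbP[u ->] /dvdbP h]].
  by split; apply/dvdbP; [exists (w * pi ^+ i); rewrite -mulrA [_ * d]mulrC|
    exists (w * d); rewrite mulrA].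
have [v ->] := gprime_pow_dvd pip nd h; exists v; ring.
Qed.

Lemma gprime_ndvd_pow rho pi d i : gprime rho -> ~~ dvdb rho d -> ~~ dvdb rho pi ->
  ~~ dvdb rho (d * pi ^+ i).
Proof.
move=> [_ ru rhoP] nd npi; elim: i => [|i IH]; first by rewrite expr0 mulr1.
apply/dvdbP; rewrite exprSr mulrA => /rhoP[]; apply/dvdbP => //.
Qed.

(* The congruence conditions at pi that (f, g, h) strongly carefree imposes on
   x = (f, h). *)
Definition good g pi (x : gaussInt * gaussInt) : bool :=
  if dvdb pi g then ~~ dvdb pi x.1 && ~~ dvdb pi x.2
  else [&& ~~ (dvdb pi x.1 && dvdb pi x.2), ~~ dvdb (pi ^+ 2) x.1
         & ~~ dvdb (pi ^+ 2) x.2].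

(* Inclusion-exclusion: the indicator of [good g pi] is the sum of the
   c [pi^i | f] [pi^j | h] over the (c, (i, j)) in this list. *)
Definition good_coefs g pi : seq (R * (nat * nat)) :=
  if dvdb pi g then [:: (1, (0, 0)%N); (-1, (1, 0)%N); (-1, (0, 1)%N); (1, (1, 1)%N)]
  else [:: (1, (0, 0)%N); (-1, (1, 1)%N); (-1, (2, 0)%N); (-1, (0, 2)%N);
           (1, (2, 1)%N); (1, (1, 2)%N)].

Lemma good_expand g pi x : (good g pi x)%:R =
  \sum_(c <- good_coefs g pi)
     c.1 * (dvdb (pi ^+ c.2.1) x.1 && dvdb (pi ^+ c.2.2) x.2)%:R.
Proof.
have sq f : dvdb (pi ^+ 2) f -> dvdb pi f.
  move=> /dvdbP[u ->]; apply/dvdbP; exists (u * pi); rewrite expr2; ring.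
rewrite /good /good_coefs; case: ifP => _;
  rewrite !big_cons big_nil /= !expr0 !expr1 !dvd1b.
  by case: (dvdb pi x.1); case: (dvdb pi x.2) => /=; ring.
have := sq x.1; have := sq x.2.
by case: (dvdb pi x.1); case: (dvdb pi x.2); case: (dvdb _ x.1);
   case: (dvdb _ x.2) => // h1 h2 /=;
   try (by move: (h1 isT)); try (by move: (h2 isT)); ring.
Qed.

(** The expected value of [good_expand]: the condition pi^i | f, pi^j | h has density N(pi)^-(i +
    j). *)
Definition local_density g pi : R :=
  \sum_(c <- good_coefs g pi) c.1 / (gabs pi ^+ 2) ^+ (c.2.1 + c.2.2).

Lemma local_densityE g pi : pi != 0 -> local_density g pi =
  if dvdb pi g then (1 - (gabs pi ^+ 2)^-1) ^+ 2
  else 1 - 3 / (gabs pi ^+ 2) ^+ 2 + 2 / (gabs pi ^+ 2) ^+ 3.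
Proof.
move=> pi0; rewrite /local_density /good_coefs; case: ifP => _;
  rewrite !big_cons big_nil /= ?addn0 ?add0n ?add1n ?addn1 ?expr0 ?expr1;
  field; by rewrite gt_eqF // gabs_gt0.
Qed.

Definition region_sum (psi : gaussInt * gaussInt -> R) T : R :=
  \sum_(x <- region_fset a b T) psi x.

(** The induction needs d and e arbitrary: expanding at the head pi turns the sum into combinations
    of the same sums for the tail, with moduli d pi^i and e pi^j. The [pairwise] hypothesis says
    that later primes do not divide earlier ones, so the tail stays prime to the new moduli. *)
Lemma region_sum_sieve g (s : seq gaussInt) d e :
  d != 0 -> e != 0 ->
  (forall pi, pi \in s -> [/\ gprime pi, ~~ dvdb pi d & ~~ dvdb pi e]) ->
  pairwise (fun pi rho => ~~ dvdb rho pi) s ->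
  region_sum (fun x => [&& dvdb d x.1, dvdb e x.2 & all (fun pi => good g pi x) s]%:R) T
     / T ^+ 4 @[T --> +oo]
  --> trigo.pi ^+ 2 * (b - a) / (gabs d ^+ 2 * gabs e ^+ 2)
      * \prod_(pi <- s) local_density g pi.
Proof.
elim: s d e => [|pi s IH] d e d0 e0 sP.
  move=> _; rewrite big_nil mulr1.
  have sumE T : region_sum (fun x =>
       [&& dvdb d x.1, dvdb e x.2 & all (fun pi => good g pi x) [::]]%:R) T =
     \sum_(x <- region_fset a b T | dvdb d x.1 && dvdb e x.2) 1.
    rewrite big_mkcond; apply: eq_bigr => x _.
    by rewrite /= andbT; case: ifP.
  by under eq_fun do rewrite sumE; exact: region_count_dvd.
rewrite pairwise_cons => /andP[/allP pis sw].
have [pip pid pie] := sP pi (mem_head _ _).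
have pi0 : pi != 0 by case: pip.
rewrite big_cons.
have -> : trigo.pi ^+ 2 * (b - a) / (gabs d ^+ 2 * gabs e ^+ 2) *
     (local_density g pi * \prod_(j <- s) local_density g j) =
  \sum_(c <- good_coefs g pi) c.1 *
    (trigo.pi ^+ 2 * (b - a) /
      (gabs (d * pi ^+ c.2.1) ^+ 2 * gabs (e * pi ^+ c.2.2) ^+ 2)
      * \prod_(j <- s) local_density g j).
  rewrite /local_density mulrA mulr_sumr mulr_suml; apply: eq_bigr => c _.
  have gX i : gabs (pi ^+ i) = gabs pi ^+ i.
    elim: i => [|i IHi]; last by rewrite !exprS gabsM IHi.
    by rewrite !expr0 /Defs.gabs rmorph1 ComplexField.Normc.normc1.
  rewrite !gabsM !gX exprD exprAC [(_ ^+ 2) ^+ c.2.2]exprAC.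
  have u0 : gabs pi ^+ c.2.1 != 0 by rewrite gt_eqF // exprn_gt0 // gabs_gt0.
  have v0 : gabs pi ^+ c.2.2 != 0 by rewrite gt_eqF // exprn_gt0 // gabs_gt0.
  move: (_ ^+ c.2.1) (_ ^+ c.2.2) u0 v0 => u v u0 v0.
  by field; rewrite u0 v0 !gt_eqF // gabs_gt0.
have sumE T : region_sum (fun x =>
     [&& dvdb d x.1, dvdb e x.2 & all (fun pi => good g pi x) (pi :: s)]%:R) T
     / T ^+ 4 =
  \sum_(c <- good_coefs g pi) c.1 * (region_sum (fun x =>
     [&& dvdb (d * pi ^+ c.2.1) x.1, dvdb (e * pi ^+ c.2.2) x.2
       & all (fun pi => good g pi x) s]%:R) T / T ^+ 4).
  rewrite /region_sum mulr_suml; under [RHS]eq_bigr do rewrite mulr_suml mulr_sumr.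
  rewrite exchange_big /=; apply: eq_bigr => x _.
  under eq_bigr do rewrite mulrA; rewrite -mulr_suml; congr (_ / _).
  rewrite [RHS](eq_bigr (fun c => c.1 *
    (dvdb (pi ^+ c.2.1) x.1 && dvdb (pi ^+ c.2.2) x.2)%:R *
    [&& dvdb d x.1, dvdb e x.2 & all (fun pi => good g pi x) s]%:R)); last first.
    move=> c _; rewrite -mulrA -natrM mulnb !dvdb_mul_pow //; congr (_ * _%:R).
    by case: (dvdb d _); case: (dvdb e _); case: (dvdb _ x.1); case: (dvdb _ x.2).
  rewrite -mulr_suml -good_expand -natrM mulnb; congr _%:R.
  by case: (good _ _ _) => //=; rewrite ?andbF.
under eq_fun do rewrite sumE.
apply: cvg_sumr => c _; apply: cvgMr; apply: IH => //.
- by rewrite mulf_neq0 // expf_neq0.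
- by rewrite mulf_neq0 // expf_neq0.
- move=> rho rhos; have [|rhop rd re] := sP rho; first by rewrite in_cons rhos orbT.
  by split => //; apply: gprime_ndvd_pow => //; exact: pis.
Qed.

End sieve.

(** * The contribution of large primes *)

Lemma ler_sum_subseq (R : numDomainType) (I : eqType) (s t : seq I) (F : I -> R) :
  (forall i, 0 <= F i) -> uniq s -> {subset s <= t} ->
  \sum_(i <- s) F i <= \sum_(i <- t) F i.
Proof.
move=> F0; elim: s t => [|i s IH] t; first by rewrite big_nil sumr_ge0.
move=> /= /andP[nis us] st; rewrite big_cons.
have it : i \in t by apply: st; rewrite mem_head.
rewrite (perm_big _ (perm_to_rem it)) big_cons lerD2l; apply: IH => // j js.
have : j \in i :: rem i t by rewrite -(perm_mem (perm_to_rem it)) st // in_cons js orbT.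
by rewrite in_cons => /predU1P[ji|//]; rewrite -ji js in nis.
Qed.

Lemma sumr1_size (R : pzSemiRingType) (I : Type) (s : seq I) :
  \sum_(i <- s) 1 = (size s)%:R :> R.
Proof. by elim: s => [|i s IH]; rewrite ?big_nil // big_cons IH nat1r. Qed.

Section tail.
Variable R : realType.
Local Notation gabs := (@gabs R).
Implicit Types (d e f g h x : gaussInt).

Lemma gabs_ge1 x : x != 0 -> 1 <= gabs x ^+ 2.
Proof. by move=> x0; rewrite gabs_sqr -[1]/(1%:~R) ler_int -gtz0_ge1 gnorm_gt0. Qed.

Lemma gdvd_gabs_le d x : x != 0 -> gdvd d x -> gabs d <= gabs x.
Proof.
by move=> x0 dx; rewrite gabs_le ?gabs_ge0 // gabs_sqr ler_int gdvd_gnorm_le.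
Qed.

Lemma gabs1 : gabs 1 = 1.
Proof. by rewrite /Defs.gabs rmorph1 ComplexField.Normc.normc1. Qed.

Lemma gabsX x n : gabs (x ^+ n) = gabs x ^+ n.
Proof. by elim: n => [|n IH]; rewrite ?expr0 ?gabs1 // !exprS gabsM IH. Qed.

Let u (m : int) : R := (1 + m%:~R ^+ 2)^-1.

Let u_ge0 m : 0 <= u m.
Proof. by rewrite invr_ge0 addr_ge0 ?sqr_ge0. Qed.

(** The series is compared with the telescoping one of terms 3/((k + 1)(k + 2)). The comparison
    amounts to (2k - 1)(k - 1) >= 0, which holds at integers but fails between 1/2 and 1; hence the
    separate case k = 0. *)
Let sum_u k : \sum_(0 <= n < k) u n%:Z <= 3 - 3 / (k%:R + 1).
Proof.
elim: k => [|k IH]; first by rewrite big_geq // add0r divr1 subrr.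
rewrite big_nat_recr //=; apply: (le_trans (lerD IH (lexx _))).
rewrite /u -(natr1 k) -[(k%:Z)%:~R]/(k%:R : R).
have k0 : 0 <= k%:R :> R by [].
have kk : 0 <= (2 * k%:R - 1) * (k%:R - 1) :> R.
  case: (k) => [|n]; first by rewrite mulr0 !sub0r mulrNN mulr1.
  rewrite -(natr1 n); have n0 : 0 <= n%:R :> R by [].
  by rewrite mulr_ge0 //; lra.
move: (k%:R) k0 kk => r r0 kk.
have r2 : 0 < 1 + r ^+ 2 by rewrite ltr_pwDl // sqr_ge0.
rewrite -subr_ge0.
have -> : 3 - 3 / (r + 1 + 1) - (3 - 3 / (r + 1) + (1 + r ^+ 2)^-1) =
  ((2 * r - 1) * (r - 1)) / ((r + 1) * (r + 1 + 1) * (1 + r ^+ 2)).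
  by field; rewrite !gt_eqF // ltr_wpDl // addr_ge0.
by rewrite divr_ge0 // mulr_ge0 ?(ltW r2) // mulr_ge0 // !addr_ge0.
Qed.

(** The integers of absolute value below k, with 0 listed twice; the repetition is harmless in an
    upper bound for a sum of nonnegative terms. *)
Let L k : seq int := [seq n%:Z | n <- index_iota 0 k] ++ [seq - n%:Z | n <- index_iota 0 k].

Let in_L m k : (absz m < k)%N -> m \in L k.
Proof.
move=> mk; rewrite mem_cat; apply/orP.
by case: (leP 0 m) => m0; [left|right]; apply/mapP; exists (absz m);
  rewrite ?mem_index_iota; lia.
Qed.

Let sum_L k : \sum_(m <- L k) u m <= 6.
Proof.
have h : \sum_(0 <= n < k) u n%:Z <= 3.
  by apply: le_trans (sum_u k) _; rewrite gerBl divr_ge0 // addr_ge0.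
rewrite /L big_cat !big_map /=.
under [X in _ + X]eq_bigr do rewrite /u rmorphN sqrrN -/(u _).
by have := lerD h h; congr (_ <= _); ring.
Qed.

(* For m + in != 0, 9 (m^2 + n^2)^2 >= 4 (1 + m^2) (1 + n^2), which reduces the double
   series to the square of a simple one. *)
Let quartic_bounded (s : seq gaussInt) : uniq s ->
  \sum_(x <- s) (gabs x ^+ 4)^-1 <= 9 / 4 * 36.
Proof.
move=> us.
pose k := (\sum_(x <- s) (absz (gre x) + absz (gim x))).+1.
pose v x := 9 / 4 * (u (gre x) * u (gim x)).
have v0 x : 0 <= v x by apply: mulr_ge0; [exact: divr_ge0|apply: mulr_ge0].
have wv x : (gabs x ^+ 4)^-1 <= v x.
  (* At x = 0 the left-hand side is 0, by the convention that the inverse of 0 is 0. *)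
  have [->|x0] := eqVneq x 0.
    by rewrite (exprM _ 2 2) gabs_sqr expr0n invr0.
  have N1 := gabs_ge1 x0.
  have NE : gabs x ^+ 2 = (gre x)%:~R ^+ 2 + (gim x)%:~R ^+ 2.
    by rewrite gabs_sqr rmorphD !rmorphXn.
  rewrite (exprM _ 2 2) /v /u -invfM -[9 / 4]invrK -invfM.
  have m0 : 0 <= (gre x)%:~R ^+ 2 :> R by rewrite sqr_ge0.
  have n0 : 0 <= (gim x)%:~R ^+ 2 :> R by rewrite sqr_ge0.
  move: N1; rewrite NE; move: (_ ^+ 2) (_ ^+ 2) m0 n0 => m n m0 n0 N1.
  rewrite lef_pV2 ?posrE; last 2 first.
  - by rewrite exprn_gt0 // (lt_le_trans _ N1).
  - by rewrite mulr_gt0 ?invr_gt0 ?divr_gt0 // mulr_gt0 // ltr_pwDl.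
  rewrite [leLHS]mulrC ler_pdivrMr ?divr_gt0 //.
  have h1 : 0 <= (m + n - 1) * (m + n) by apply: mulr_ge0; lra.
  have h2 := sqr_ge0 (m - n); lra.
apply: (@le_trans _ _ (\sum_(x <- s) v x)); first exact: ler_sum.
apply: (@le_trans _ _ (\sum_(x <- [seq GaussInt m n | m <- L k, n <- L k]) v x)).
  apply: ler_sum_subseq => // x xs; apply/allpairsP.
  exists (gre x, gim x); split; last exact: gaussInt_eqP.
  - by apply: in_L; rewrite ltnS (big_rem x) //= -addnA leq_addr.
  - by apply: in_L; rewrite ltnS (big_rem x) //= addnAC leq_addl.
rewrite big_allpairs_dep /v /=.
under eq_bigr do rewrite -!mulr_sumr.
rewrite -mulr_sumr ler_wpM2l ?divr_ge0 // -mulr_suml.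
have -> : (36 : R) = 6 * 6 by ring.
by apply: ler_pM; rewrite ?sum_L // sumr_ge0.
Qed.

(** A finite s0 whose sum is within eps of the supremum leaves at most eps to any s disjoint from
    it. With z the total of the norms over s0, an element of norm above z cannot lie in s0. *)
Lemma quartic_tail (eps : R) : 0 < eps -> exists2 z : R, 0 <= z &
  forall s : seq gaussInt, uniq s -> (forall x, x \in s -> z < gabs x ^+ 2) ->
  \sum_(x <- s) (gabs x ^+ 4)^-1 <= eps.
Proof.
move=> eps0.
pose E := [set (\sum_(x <- s) (gabs x ^+ 4)^-1 : R) | s in [set s : seq gaussInt | uniq s]].
have supE : has_sup E.
  split; first by exists 0; exists [::] => //; rewrite big_nil.
  by exists (9 / 4 * 36) => _ [s us <-]; exact: quartic_bounded.
have [_ [s0 us0 <-] hs0] := sup_adherent eps0 supE.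
exists (\sum_(x <- s0) gabs x ^+ 2); first by rewrite sumr_ge0 // => x _; exact: sqr_ge0.
move=> s us sz.
have us' : uniq (s0 ++ s).
  rewrite cat_uniq us0 us andbT; apply/hasPn => x /sz xz; apply/negP => xs0.
  move: xz; rewrite ltNge (big_rem x) //= lerDl sumr_ge0 // => y _; exact: sqr_ge0.
have : \sum_(x <- s0 ++ s) (gabs x ^+ 4)^-1 <= sup E.
  by apply: ub_le_sup; [case: supE|exists (s0 ++ s)].
rewrite big_cat /=; move: hs0; lra.
Qed.

Let nonzero_card d (t : R) : 0 <= t ->
  (\sum_(x <- gball d t | x != 0) 1 : R) = #|` gball d t|%:R - 1.
Proof.
move=> t0; have z0 : 0 \in gball d t.
  rewrite in_gball; apply/andP; split; first by apply/dvdbP; exists 0; rewrite mul0r.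
  by rewrite gabs_le // (_ : gnorm 0 = 0) ?sqr_ge0.
by rewrite natr_card_fset (bigD1_seq 0) ?fset_uniq //= addrAC subrr add0r.
Qed.

(** Leaving out 0 makes the bound uniform in d without an additive constant: for t < |d| the disc
    contains no nonzero multiple of d. Division by d reduces to the case d = 1. *)
Lemma nonzero_count_bound : exists2 K : R, 0 < K & forall d (t : R), d != 0 -> 0 <= t ->
  (\sum_(x <- gball d t | x != 0) 1 : R) <= K * t ^+ 2 / gabs d ^+ 2.
Proof.
have [C hC] := @card_gball_approx R 1 (oner_neq0 _) 1 ltr01.
pose K := pi / gabs 1 ^+ 2 + 1 + `|C|.
have K0 : 0 < K by rewrite ltr_pwDl // ltr_wpDl // divr_ge0 ?pi_ge0 ?sqr_ge0.
have h1 (t : R) : 0 <= t -> #|` gball 1 t|%:R - 1 <= K * t ^+ 2.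
  move=> t0; have [t1|t1] := leP 1 t; last first.
    rewrite -nonzero_card // big_seq_cond big1 ?mulr_ge0 ?(ltW K0) ?sqr_ge0 //.
    move=> x /andP[+ x0]; rewrite in_gball => /andP[_].
    rewrite gabs_le // => /(le_trans (_ : 1 <= _)).
    by rewrite -gabs_sqr (gabs_ge1 x0) => /(_ isT); rewrite expr_ge1 // leNgt t1.
  have := hC t t0; rewrite ler_norml => /andP[_].
  have : `|C| <= `|C| * t ^+ 2 by rewrite ler_peMr // expr_ge1.
  have := ler_norm C; rewrite /K; lra.
exists K => // d t d0 t0; rewrite nonzero_card // card_gball //.
apply: le_trans (h1 _ _) _; first by rewrite divr_ge0 // gabs_ge0.
by rewrite expr_div_n mulrA.
Qed.

Variables (a b : R).
Hypotheses (a0 : 0 < a) (ab : a <= b).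

(** A common radius, in units of T, for f and h: [region_bound] gives b a^(-1/4) and a^(-1/4). *)
Let be := (1 + b) * root4V a.

Let be_gt0 : 0 < be.
Proof. by rewrite mulr_gt0 ?root4V_gt0 // ltr_pwDl // ltW // (lt_le_trans a0). Qed.

Let region_ball (T : R) (x : gaussInt * gaussInt) : 0 < T -> region a b T x ->
  [/\ x.1 != 0, x.2 != 0, gabs x.1 <= be * T & gabs x.2 <= be * T].
Proof.
move=> T0 rx; have [h1 h2] := region_bound a0 ab (ltW T0) rx.
case: rx => x0 h3 _ _.
have b0 : 0 < b by apply: lt_le_trans ab.
have aT : 0 < root4V a * T by rewrite mulr_gt0 ?root4V_gt0.
split => //.
- by rewrite -(@gabs_gt0 R); apply: lt_le_trans h3; rewrite mulr_gt0 ?gabs_gt0.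
- by apply: le_trans h2 _; rewrite /be -mulrA ler_pM2r // lerDr.
- by apply: le_trans h1 _; rewrite /be -mulrA ler_peMl ?(ltW aT) // lerDl ltW.
Qed.

Lemma region_count_bound : exists2 K : R, 0 < K & forall d e (T : R),
  d != 0 -> e != 0 -> 0 < T ->
  (\sum_(x <- region_fset a b T | dvdb d x.1 && dvdb e x.2) 1 : R) <=
  K * T ^+ 4 / (gabs d ^+ 2 * gabs e ^+ 2).
Proof.
have [K K0 hK] := nonzero_count_bound.
exists (K ^+ 2 * be ^+ 4); first by rewrite mulr_gt0 ?exprn_gt0.
move=> d e T d0 e0 T0; have beT : 0 <= be * T by rewrite mulr_ge0 // ltW.
have := ler_pM (sumr_ge0 _ (fun _ _ => ler01)) (sumr_ge0 _ (fun _ _ => ler01))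
  (hK d _ d0 beT) (hK e _ e0 beT).
have -> : K * (be * T) ^+ 2 / gabs d ^+ 2 * (K * (be * T) ^+ 2 / gabs e ^+ 2) =
  K ^+ 2 * be ^+ 4 * T ^+ 4 / (gabs d ^+ 2 * gabs e ^+ 2).
  by field; rewrite !gt_eqF ?gabs_gt0.
apply: le_trans.
rewrite -big_filter -[X in _ <= X * _]big_filter -[X in _ <= _ * X]big_filter.
rewrite !sumr1_size -natrM -(size_allpairs pair) -!sumr1_size.
apply: ler_sum_subseq => //; first by rewrite filter_uniq ?fset_uniq.
move=> x; rewrite mem_filter => /andP[/andP[dx ex]].
rewrite (in_region a0 ab _ (ltW T0)) => /set_mem /(region_ball T0)[x1 x2 h1 h2].
apply/allpairsP; exists x; rewrite !mem_filter !in_gball dx ex x1 x2 h1 h2.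
by split => //; case: (x).
Qed.

(** Here d is any Gaussian integer, prime or not, so the union bound is directly a tail of the sum
    of N(d)^-2. *)
Definition bad (z : R) (x : gaussInt * gaussInt) : bool :=
  `[< exists2 d, z < gabs d ^+ 2 & [|| dvdb (d ^+ 2) x.1, dvdb (d ^+ 2) x.2
        | dvdb d x.1 && dvdb d x.2] >].

(** A union bound: each of the three conditions falls under [region_count_bound], with moduli (d^2,
    1), (1, d^2) and (d, d), and costs K T^4 / N(d)^2; hence the factor 3. Only finitely many d
    occur, since d divides f or h, both nonzero and of absolute value at most [be * T]. *)
Lemma bad_count_bound : exists2 K : R, 0 < K & forall z T sigma : R,
  0 <= z -> 0 < T ->
  (forall s : seq gaussInt, uniq s -> (forall x, x \in s -> z < gabs x ^+ 2) ->
    \sum_(x <- s) (gabs x ^+ 4)^-1 <= sigma) ->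
  (\sum_(x <- region_fset a b T | bad z x) 1 : R) <= K * T ^+ 4 * sigma.
Proof.
have [K K0 hK] := region_count_bound.
exists (3 * K); first by rewrite mulr_gt0.
move=> z T sigma z0 T0 hs.
pose D := [seq d <- gball 1 (be * T) | z < gabs d ^+ 2].
have uD : uniq D by rewrite filter_uniq // fset_uniq.
pose ind (c : bool) : R := c%:R.
have ind0 c : 0 <= ind c by [].
apply: (@le_trans _ _ (\sum_(d <- D) \sum_(x <- region_fset a b T)
   (ind (dvdb (d ^+ 2) x.1) + ind (dvdb (d ^+ 2) x.2) +
    ind (dvdb d x.1 && dvdb d x.2)))).
  rewrite exchange_big big_mkcond /= big_seq [leRHS]big_seq.
  apply: ler_sum => x; rewrite (in_region a0 ab _ (ltW T0)) => /set_mem /(region_ball T0).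
  move=> [x1 x2 h1 h2].
  have rhs0 d : 0 <= ind (dvdb (d ^+ 2) x.1) + ind (dvdb (d ^+ 2) x.2) +
      ind (dvdb d x.1 && dvdb d x.2) by rewrite !addr_ge0.
  case: ifP => [/asboolP[d zd hd]|_]; last by rewrite sumr_ge0.
  have dD : d \in D.
    rewrite mem_filter zd in_gball dvd1b /=.
    have sq y : dvdb (d ^+ 2) y -> gdvd d y.
      by move=> /dvdbP[v ->]; exists (v * d); rewrite expr2 mulrA.
    case/or3P: hd => [/sq h|/sq h|/andP[/dvdbP h _]].
    - exact: le_trans (gdvd_gabs_le x1 h) h1.
    - exact: le_trans (gdvd_gabs_le x2 h) h2.
    - exact: le_trans (gdvd_gabs_le x1 h) h1.
  rewrite (big_rem d) //= ler_wpDr ?sumr_ge0 //.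
  move: hd; rewrite /ind; case: (dvdb _ x.1); case: (dvdb _ x.2);
    case: (_ && _) => //= _; lra.
apply: (@le_trans _ _ (\sum_(d <- D) 3 * K * T ^+ 4 * (gabs d ^+ 4)^-1)); last first.
  rewrite -mulr_sumr ler_wpM2l ?hs //.
    by rewrite !mulr_ge0 ?exprn_ge0 // ltW.
  by move=> x; rewrite mem_filter => /andP[].
rewrite big_seq [leRHS]big_seq; apply: ler_sum => d.
rewrite mem_filter => /andP[zd _].
have d0 : d != 0.
  apply: contraTneq zd => ->; rewrite -leNgt; apply: le_trans z0.
  by rewrite gabs_sqr.
rewrite !big_split /=.
have cnt c e : c != 0 -> e != 0 -> gabs c ^+ 2 * gabs e ^+ 2 = gabs d ^+ 4 ->
    \sum_(x <- region_fset a b T) ind (dvdb c x.1 && dvdb e x.2) <=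
      K * T ^+ 4 / gabs d ^+ 4.
  move=> c0 e0 <-; apply: le_trans (hK c e T c0 e0 T0).
  by rewrite [leRHS]big_mkcond; apply: ler_sum => x _; case: ifP.
have d20 : d ^+ 2 != 0 by rewrite expf_neq0.
have d4 : gabs d ^+ 2 ^+ 2 = gabs d ^+ 4 by rewrite -exprM.
have h1 := cnt (d ^+ 2) 1 d20 (oner_neq0 _).
have h2 := cnt 1 (d ^+ 2) (oner_neq0 _) d20.
have h3 := cnt d d d0 d0.
rewrite gabsX gabs1 expr1n mulr1 in h1; rewrite gabsX gabs1 expr1n mul1r in h2.
rewrite -expr2 in h3; move: {h1 h2 h3} (h1 d4) (h2 d4) (h3 d4) => h1 h2 h3.
rewrite (eq_bigr (fun w : gaussInt * gaussInt => ind (dvdb (d ^+ 2) w.1))) in h1; last first.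
  by move=> x _; rewrite dvd1b andbT.
rewrite (eq_bigr (fun w : gaussInt * gaussInt => ind (dvdb (d ^+ 2) w.2))) in h2; last first.
  by move=> x _; rewrite dvd1b.
apply: le_trans (lerD (lerD h1 h2) h3) _.
by rewrite le_eqVlt; apply/orP; left; apply/eqP; ring.
Qed.

End tail.

(** * Density of carefree pairs *)

Lemma prime_gen_exists (p : nonzero_prime) :
  exists2 pi, gprime pi & val p = principal pi.
Proof. exact/nonzero_primeP/set_mem/valP. Qed.

Definition prime_gen (p : nonzero_prime) : gaussInt := s2val (cid2 (prime_gen_exists p)).

Section prime_gen.
Implicit Types p q : nonzero_prime.

Lemma prime_gen_prime p : gprime (prime_gen p).
Proof. exact: s2valP (cid2 (prime_gen_exists p)). Qed.

Lemma prime_genE p : val p = principal (prime_gen p).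
Proof. exact: s2valP' (cid2 (prime_gen_exists p)). Qed.

Lemma prime_gen_neq0 p : prime_gen p != 0.
Proof. by case: (prime_gen_prime p). Qed.

Lemma prime_gen_inj : injective prime_gen.
Proof. by move=> p q pq; apply: val_inj; rewrite /= !prime_genE pq. Qed.

Lemma prime_gen_dvd p q : gdvd (prime_gen p) (prime_gen q) -> p = q.
Proof.
case: (prime_gen_prime p) => p0 pu _; case: (prime_gen_prime q) => q0 _ qP.
move=> pq; have qp : gdvd (prime_gen q) (prime_gen p).
  case: pq => w wE; have [|[v vE]|//] := qP w (prime_gen p).
    by rewrite -wE; exact: gdvd_refl.
  case: (negP pu); have : v * prime_gen p = 1.
    by apply: (mulIf q0); rewrite mul1r mulrAC -vE -wE.
  by move=> h; apply/unitrPr; exists v; rewrite mulrC.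
apply: val_inj; rewrite /= !prime_genE; apply/seteqP.
by split => x; exact: gdvd_trans.
Qed.

Lemma gprime_assoc_gen pi : gprime pi ->
  exists p, gdvd (prime_gen p) pi /\ gnorm (prime_gen p) = gnorm pi.
Proof.
move=> pip; have h : nonzero_prime (principal pi) by apply/nonzero_primeP; exists pi.
pose p : nonzero_prime := SigSub (mem_set h).
have pE : principal (prime_gen p) = principal pi by rewrite -prime_genE.
exists p; split; last exact: (principal_inj (prime_gen_neq0 p)).
by change (principal (prime_gen p) pi); rewrite pE; exact: gdvd_refl.
Qed.

Lemma mem_prime p x : (x \in val p) = dvdb (prime_gen p) x.
Proof.
by apply/idP/asboolP => [/set_mem|h]; rewrite prime_genE //; exact/mem_set.
Qed.

End prime_gen.

Section prime_products.
Variable R : realType.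
Local Notation gabs := (@gabs R).
Implicit Types (p : nonzero_prime) (A : {fset nonzero_prime}) (g : gaussInt).

Lemma ideal_norm_gen p : (ideal_norm (val p))%:R = gabs (prime_gen p) ^+ 2 :> R.
Proof.
rewrite prime_genE ideal_norm_principal ?prime_gen_neq0 // gabs_sqr.
by rewrite natr_absz ger0_norm // gnorm_ge0.
Qed.

Lemma finite_prime_gen_le (z : R) :
  finite_set [set p | gabs (prime_gen p) <= z].
Proof.
apply: (finite_preimage (f := prime_gen) (B := [set x | gabs x <= z])).
  by move=> p q _ _; exact: prime_gen_inj.
exact: finite_gabs_le.
Qed.

Definition prime_weight (P : set gaussInt) : R :=
  (ideal_norm P)%:R / ((ideal_norm P)%:R + 2).

Lemma local_density_gen g p : local_density R g (prime_gen p) =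
  euler_factor R (val p) * (if dvdb (prime_gen p) g then prime_weight (val p) else 1).
Proof.
rewrite local_densityE ?prime_gen_neq0 // /euler_factor /prime_weight ideal_norm_gen.
have : 0 < gabs (prime_gen p) ^+ 2 by rewrite exprn_gt0 // gabs_gt0 prime_gen_neq0.
move: (_ ^+ 2) => N N0; case: ifP => _; last by rewrite mulr1.
by field; rewrite !gt_eqF // addr_gt0.
Qed.

Lemma prod_local_density g A : g != 0 ->
  (forall p, dvdb (prime_gen p) g -> p \in A) ->
  \prod_(pi <- [seq prime_gen p | p <- A]) local_density R g pi =
  euler_partial R A *
  \big[*%R/1]_(P \in [set P | nonzero_prime P /\ g \in P]) prime_weight P.
Proof.
move=> g0 gA; rewrite big_map; under eq_bigr do rewrite local_density_gen.
rewrite big_split /=; congr (_ * _).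
have fin : finite_set [set P | nonzero_prime P /\ g \in P].
  apply: (@sub_finite_set _ _ (principal @` [set d | gabs d <= gabs g])).
    move=> P [/nonzero_primeP[pi pip ->] /set_mem gP]; exists pi => //=.
    exact: gdvd_gabs_le.
  by apply: finite_image; exact: finite_gabs_le.
rewrite fsbig_finite //= -big_mkcond -big_filter -(big_map val xpredT).
apply: perm_big; apply: uniq_perm.
- by rewrite map_inj_uniq ?filter_uniq ?fset_uniq //; exact: val_inj.
- exact: fset_uniq.
move=> P; rewrite in_fset_set //; apply/mapP/idP => [[p + ->]|/set_mem[Pp gP]].
  rewrite mem_filter => /andP[pg _]; apply/mem_set; split; last by rewrite mem_prime.
  exact/set_mem/valP.
exists (SigSub (mem_set Pp) : nonzero_prime) => //.
have hg : dvdb (prime_gen (SigSub (mem_set Pp) : nonzero_prime)) g by rewrite -mem_prime.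
by rewrite mem_filter hg gA.
Qed.

End prime_products.

Section carefree_density.
Variables (R : realType) (a b : R) (g : gaussInt).
Hypotheses (a0 : 0 < a) (ab : a <= b) (sqg : squarefree g).
Local Notation gabs := (@gabs R).
Implicit Types (d e f h pi : gaussInt) (p : nonzero_prime).

Definition carefree (x : gaussInt * gaussInt) : bool :=
  `[< strongly_carefree x.1 g x.2 >].

Let g0 : g != 0. Proof. by case: sqg. Qed.

Lemma carefree_good pi x : gprime pi -> carefree x -> good g pi x.
Proof.
move=> [_ piu _] /asboolP[[[_ sf] _ [_ sh]] [cfg cfh cgh]]; rewrite /good.
case: (boolP (dvdb pi g)) => [/dvdbP pg|_].
  apply/andP; split; apply: contra piu => /dvdbP h; first exact: (cfg pi).
  exact: (cgh pi).
apply/and3P; split; apply: contra piu.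
- by move=> /andP[/dvdbP h1 /dvdbP h2]; exact: (cfh pi).
- by move=> /dvdbP /sf.
- by move=> /dvdbP /sh.
Qed.

(** A failure of carefreeness yields a prime that divides two of f, g, h or whose square divides f
    or h. Its norm is at most z: when it divides g because N(g) <= z, otherwise because x is not
    bad. The chosen generator of its ideal then lies in A and violates [good]. *)
Lemma good_carefree (z : R) (A : {fset nonzero_prime}) x :
  gabs g ^+ 2 <= z -> (forall p, gabs (prime_gen p) ^+ 2 <= z -> p \in A) ->
  x.1 != 0 -> x.2 != 0 -> {in A, forall p, good g (prime_gen p) x} ->
  ~~ bad z x -> carefree x.
Proof.
move=> gz Az x1 x2 gx nbad.
have small pi : gprime pi -> gabs pi ^+ 2 <= z ->
    exists rho, [/\ gdvd rho pi, good g rho x & rho \isn't a GRing.unit].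
  move=> pip piz; have [p [pd pn]] := gprime_assoc_gen pip.
  exists (prime_gen p); split => //; last by case: (prime_gen_prime p).
  by apply: gx; apply: Az; rewrite gabs_sqr pn -gabs_sqr.
have le_z pi : ~~ [|| dvdb (pi ^+ 2) x.1, dvdb (pi ^+ 2) x.2
        | dvdb pi x.1 && dvdb pi x.2] \/ gabs pi ^+ 2 <= z.
  have [zpi|] := ltP z (gabs pi ^+ 2); last by right.
  by left; apply: contra nbad => h; apply/asboolP; exists pi.
have sqdvd d e : gdvd d e -> gdvd (d ^+ 2) (e ^+ 2).
  by move=> [w ->]; exists (w ^+ 2); rewrite exprMn.
have dsq d : gdvd d (d ^+ 2) by exists d; rewrite expr2.
have sqf y : (forall rho, good g rho x -> gdvd (rho ^+ 2) y -> False) ->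
    (forall pi, gdvd (pi ^+ 2) y -> gabs pi ^+ 2 <= z) ->
    y != 0 -> squarefree y.
  move=> hgood hz y0; split => // d dy; apply: contrapT => /negP du.
  have d0 : d != 0.
    by apply: contraNneq y0 => d0; case: dy => w ->; rewrite d0 expr0n mulr0.
  have [pi pip pd] := exists_gprime_dvd d0 du.
  have piy : gdvd (pi ^+ 2) y by apply: gdvd_trans dy; exact: sqdvd.
  have [rho [rpi rg _]] := small pi pip (hz pi piy).
  by apply: (hgood rho rg); apply: gdvd_trans piy; exact: sqdvd.
have cop y w : (forall rho, good g rho x -> gdvd rho y -> gdvd rho w -> False) ->
    (forall pi, gdvd pi y -> gdvd pi w -> gabs pi ^+ 2 <= z) ->
    y != 0 -> gcoprime y w.
  move=> hgood hz y0 d dy dw; apply: contrapT => /negP du.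
  have d0 : d != 0.
    by apply: contraNneq y0 => d0; case: dy => v ->; rewrite d0 mulr0.
  have [pi pip pd] := exists_gprime_dvd d0 du.
  have piy := gdvd_trans pd dy; have piw := gdvd_trans pd dw.
  have [rho [rpi rg _]] := small pi pip (hz pi piy piw).
  by apply: (hgood rho rg); apply: gdvd_trans rpi _.
have g_le pi : gdvd pi g -> gabs pi ^+ 2 <= z.
  move=> h; apply: le_trans gz; rewrite lerXn2r ?nnegrE ?gabs_ge0 //.
  exact: gdvd_gabs_le.
apply/asboolP; split; split => //.
- apply: sqf => // [rho|pi /dvdbP h].
    rewrite /good; case: ifP => _.
      move=> /andP[/dvdbP h _] h'; apply: h; exact: gdvd_trans (dsq rho) h'.
    by move=> /and3P[_ /dvdbP].
  by case: (le_z pi) => //; rewrite h.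
- apply: sqf => // [rho|pi /dvdbP h].
    rewrite /good; case: ifP => _.
      move=> /andP[_ /dvdbP h] h'; apply: h; exact: gdvd_trans (dsq rho) h'.
    by move=> /and3P[_ _ /dvdbP].
  by case: (le_z pi) => //; rewrite h orbT.
- apply: cop => // [rho|pi _]; last exact: g_le.
  by move=> + /dvdbP h1 /dvdbP h2; rewrite /good h2 h1.
- apply: cop => // [rho|pi /dvdbP h1 /dvdbP h2].
    by move=> + /dvdbP h1 /dvdbP h2; rewrite /good h2 h1; case: ifP.
  by case: (le_z pi) => //; rewrite h1 h2 !orbT.
- apply: cop => // [rho|pi h _]; last exact: g_le.
  by move=> + /dvdbP h1 /dvdbP h2; rewrite /good h2 h1 andbF.
Qed.

(** The parameters are chosen in the order z, A, T, each paying eps/3: z for the bad pairs uniformly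
    in T, A for the Euler product, and T for the sieve over the now fixed set A. *)
Lemma carefree_density :
  (\sum_(x <- region_fset a b T) (carefree x)%:R : R) / T ^+ 4 @[T --> +oo]
  --> pi ^+ 2 * (b - a) * (euler_product R *
  \big[*%R/1]_(P \in [set P | nonzero_prime P /\ g \in P]) prime_weight R P).
Proof.
set phi := \big[_/_]_(_ \in _) _; set kappa := pi ^+ 2 * (b - a).
apply (proj2 (@cvg_pinftyP R _ _)) => eps eps0.
have [K K0 hK] := bad_count_bound a0 ab.
have eps3 : 0 < eps / 3 by rewrite divr_gt0.
have [z0 z00 hz0] := @quartic_tail R (eps / 3 / K) (divr_gt0 eps3 K0).
pose z := Num.max z0 (gabs g ^+ 2).
have z_ge0 : 0 <= z by rewrite le_max z00.
have zg : gabs g ^+ 2 <= z by rewrite le_max lexx orbT.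
(* The Euler product enters multiplied by kappa phi, so it is approximated within eps/(3c); the
   added 1 keeps c positive. *)
pose c := `|kappa * phi| + 1; have c0 : 0 < c by rewrite ltr_pwDr.
have /cvgrPdist_le/(_ _ (divr_gt0 eps3 c0)) [A1 _ hA1] := @is_cvg_euler_partial R.
(* A contains A1, for the Euler product, and all primes of norm at most z, for [good_carefree]. As
   N(g) <= z, every prime dividing g belongs to it. *)
pose A := (A1 `|` fset_set [set p : nonzero_prime | (gabs (prime_gen p) <= Num.sqrt z)%R])%fset.
have Az p : gabs (prime_gen p) ^+ 2 <= z -> p \in A.
  move=> pz; rewrite in_fsetU in_fset_set; last exact: finite_prime_gen_le.
  apply/orP; right; apply/mem_set => /=.
  by rewrite -[leLHS]ger0_norm ?gabs_ge0 // -sqrtr_sqr ler_wsqrtr.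
have gA p : dvdb (prime_gen p) g -> p \in A.
  move=> /dvdbP h; apply: Az; apply: le_trans zg.
  by rewrite lerXn2r ?nnegrE ?gabs_ge0 // gdvd_gabs_le.
have {hA1} hA : `|euler_product R - euler_partial R A| <= eps / 3 / c.
  by apply: hA1; apply: fsubsetUl.
pose s := [seq prime_gen p | p <- A].
have sP pi : pi \in s -> [/\ gprime pi, ~~ dvdb pi 1 & ~~ dvdb pi 1].
  move=> /mapP[p _ ->]; have pp := prime_gen_prime p.
  suff h : ~~ dvdb (prime_gen p) 1 by [].
  case: pp => _ pu _; apply: contra pu => /dvdbP h.
  by apply: gdvd_unit h _; exact: unitr1.
have sW : pairwise (fun pi rho => ~~ dvdb rho pi) s.
  rewrite /s pairwise_map.
  have := fset_uniq A; rewrite uniq_pairwise; apply: sub_pairwise => p q /= pq.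
  by apply: contra pq => /dvdbP/prime_gen_dvd ->.
have := @region_sum_sieve R a b a0 ab g s 1 1 (oner_neq0 _) (oner_neq0 _) sP sW.
rewrite prod_local_density // -/phi gabs1 expr1n mulr1 divr1 -/kappa.
move=> /(proj1 (@cvg_pinftyP R _ _))/(_ _ eps3)[M hM].
exists (Num.max 1 M) => T; rewrite ge_max => /andP[T1 /hM {hM}].
have T0 : 0 < T by apply: lt_le_trans T1.
have T4 : 0 < T ^+ 4 by rewrite exprn_gt0.
set S := region_sum _ _ _ _; set C := \sum_(x <- _) _ => h1.
(* Carefree pairs pass the sieve, and a pair that passes without being carefree is bad; the two
   indicators thus differ only on bad pairs. *)
have h2 : `|C - S| <= K * T ^+ 4 * (eps / 3 / K).
  apply: le_trans (hK z T _ z_ge0 T0 _); last first.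
    move=> t ut tz; apply: hz0 => // x /tz; apply: le_lt_trans.
    by rewrite le_max lexx.
  rewrite /C /S /region_sum -sumrB; apply: le_trans (ler_norm_sum _ _ _) _.
  rewrite [leRHS]big_mkcond big_seq [leRHS]big_seq; apply: ler_sum => x.
  rewrite (in_region a0 ab _ (ltW T0)) !dvd1b /= => /set_mem rx.
  have x2 : x.2 != 0 by case: rx.
  have x1 : x.1 != 0.
    rewrite -(@gabs_gt0 R); case: rx => _ h _ _; apply: lt_le_trans h.
    by rewrite mulr_gt0 ?gabs_gt0.
  case: (boolP (carefree x)) => [cx|ncx].
    rewrite (_ : all _ s) ?subrr ?normr0; first by case: ifP.
    by apply/allP => pi /sP[pip _ _]; exact: carefree_good.
  rewrite sub0r normrN normr_nat; case: (boolP (all _ s)) => [|_]; last by case: ifP.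
  move=> /allP gs; rewrite ifT //; apply: contraR ncx; apply: (good_carefree zg Az) => //.
  by move=> p pA; apply: gs; apply/mapP; exists p.
have h3 : `|C / T ^+ 4 - S / T ^+ 4| <= eps / 3.
  rewrite -mulrBl normrM normfV (gtr0_norm T4) ler_pdivrMr //.
  apply: le_trans h2 _; rewrite le_eqVlt; apply/orP; left; apply/eqP.
  by field; rewrite gt_eqF.
have h4 : `|kappa * (euler_partial R A * phi) - kappa * (euler_product R * phi)| <= eps / 3.
  have -> : kappa * (euler_partial R A * phi) - kappa * (euler_product R * phi) =
    - ((kappa * phi) * (euler_product R - euler_partial R A)) by ring.
  rewrite normrN normrM; apply: (@le_trans _ _ (c * (eps / 3 / c))).
    by apply: ler_pM => //; rewrite lerDl.
  by rewrite mulrC divfK // gt_eqF.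
move: h1 h3 h4; rewrite !ler_norml; lra.
Qed.

End carefree_density.

(** * Counting triples *)

Section triples.
Variables (R : realType) (a b c d : R).
Hypotheses (a0 : 0 < a) (ab : a <= b) (c0 : 0 < c).
Local Notation gabs := (@gabs R).

Definition root4 (x : R) : R := Num.sqrt (Num.sqrt x).

Let root4_ge0 x : 0 <= root4 x. Proof. exact: sqrtr_ge0. Qed.

Let root4X x : 0 <= x -> root4 x ^+ 4 = x.
Proof. by move=> x0; rewrite (exprM _ 2 2) sqr_sqrtr ?sqrtr_ge0 // sqr_sqrtr. Qed.

Let rect : set (R * R) := `[a, b] `*` `[c, d].

Definition squarefree_ball : {fset gaussInt} :=
  fset_set [set g | squarefree g /\ c <= gabs g <= d].

Lemma in_squarefree_ball g :
  (g \in squarefree_ball) = (g \in [set g | squarefree g /\ c <= gabs g <= d]).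
Proof.
rewrite in_fset_set //; apply: sub_finite_set (@finite_gabs_le R d).
by move=> x /= [_ /andP[]].
Qed.

Let triplesE (X : R) t : 0 < X -> carefree_triples rect X t <->
  [/\ squarefree t.1.2, c <= gabs t.1.2 <= d, carefree t.1.2 (t.1.1, t.2) &
      region a b (root4 (X / gabs t.1.2 ^+ 2)) (t.1.1, t.2)].
Proof.
move=> X0; case: t => [[f g] h] /=.
have hT : g != 0 -> h != 0 -> (gabs f * gabs g ^+ 2 * gabs h ^+ 3 <= X) =
     (gabs f * gabs h ^+ 3 <= root4 (X / gabs g ^+ 2) ^+ 4).
  move=> g0 h0; have g2 : 0 < gabs g ^+ 2 by rewrite exprn_gt0 // gabs_gt0.
  by rewrite root4X ?divr_ge0 ?(ltW X0) ?(ltW g2) // ler_pdivlMr // mulrAC.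
have hS : h != 0 -> (a <= gabs f / gabs h <= b) =
    (a * gabs h <= gabs f) && (gabs f <= b * gabs h).
  by move=> h0; rewrite ler_pdivlMr ?ler_pdivrMr // gabs_gt0.
split => [[/= sc hX [/= hs hg]]|[sg hg /asboolP /= sc [/= h0 h1 h2 h3]]].
  have [[_ sg [h0 _]] _] := sc; have g0 : g != 0 by case: sg.
  move: hs hg; rewrite /= !in_itv /= => hs hg.
  move: hs; rewrite hS // => /andP[h1 h2].
  by split => //; [exact/asboolP|split => //=; rewrite -hT].
have g0 : g != 0 by case: sg.
split => //; first by rewrite /= hT.
by split; rewrite /= in_itv //= hS // h1 h2.
Qed.

(** [fset_set] is empty on an infinite set, so [carefree_count] is a true count only once this is
    known. As |g| >= c, the region attached to g lies in the one attached to c. *)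
Let finite_triples (X : R) : 0 < X -> finite_set (carefree_triples rect X).
Proof.
move=> X0; pose T := root4 (X / c ^+ 2).
apply: (@sub_finite_set _ _ ((fun y => (y.1.1, y.2, y.1.2)) @`
   (region a b T `*` [set g | gabs g <= d]))); last first.
  apply: finite_image; apply: finite_setX; last exact: finite_gabs_le.
  exact: (finite_region a0 ab (root4_ge0 _)).
move=> t /(triplesE _ X0) [_ /andP[cg gd] _ [/= h0 h1 h2 h3]].
exists ((t.1.1, t.2), t.1.2); last by case: (t) => [[]].
split => //; split => //=; apply: le_trans h3 _.
have c2 : 0 < c ^+ 2 by rewrite exprn_gt0.
have cg2 : c ^+ 2 <= gabs t.1.2 ^+ 2 by rewrite lerXn2r ?nnegrE ?gabs_ge0 // ltW.
have g2 := lt_le_trans c2 cg2.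
rewrite !root4X ?divr_ge0 ?(ltW X0) ?(ltW c2) ?(ltW g2) //.
by rewrite ler_pM2l // lef_pV2.
Qed.

Lemma carefree_count_sum (X : R) : 0 < X -> (carefree_count rect X)%:R =
  \sum_(g <- squarefree_ball)
    \sum_(x <- region_fset a b (root4 (X / gabs g ^+ 2))) (carefree g x)%:R :> R.
Proof.
move=> X0; rewrite /carefree_count natr_card_fset.
rewrite (@sum_fset_fiber _ _ _ _ squarefree_ball xpredT (fun t => t.1.2)) /=; last first.
  move=> t; rewrite in_fset_set; last exact: finite_triples.
  move=> /set_mem /(triplesE _ X0)[sg hg _ _] _.
  by rewrite in_squarefree_ball; exact/mem_set.
rewrite big_seq [RHS]big_seq; apply: eq_bigr => g.
rewrite in_squarefree_ball => /set_mem[sg hg].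
set T := root4 _; pose B := [fset x in region_fset a b T | carefree g x]%fset.
transitivity (\sum_(x <- B) 1 : R).
  apply: (@sum_fset_reindex _ _ _ _ _ B (fun x => (x.1, g, x.2))).
    by move=> [f h] [f' h'] _ _ /= [-> ->].
  move=> t; rewrite in_fset_set; last exact: finite_triples.
  apply: (iffP andP) => [[/set_mem/(triplesE _ X0)[_ _ cf rx] /eqP tg]|].
    exists (t.1.1, t.2); last by rewrite -tg; case: (t) => [[]].
    rewrite !inE /= (in_region a0 ab _ (root4_ge0 _)) -tg cf andbT.
    exact/mem_set.
  move=> [[f h]]; rewrite !inE /= (in_region a0 ab _ (root4_ge0 _)) => /andP[/set_mem rx cf] <-.
  by split => //; apply/mem_set/(triplesE _ X0).
rewrite [RHS](eq_bigr (fun x => if carefree g x then 1 else 0)); last first.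
  by move=> x _; case: ifP.
rewrite -big_mkcond; apply/esym; apply: (@sum_fset_reindex _ _ _ _ _ B id) => // x.
apply: (iffP andP) => [[h1 h2]|[y + <-]]; last by rewrite !inE => /andP[].
by exists x; rewrite // !inE h1.
Qed.

Lemma carefree_count_limit :
  (carefree_count rect X)%:R / X @[X --> +oo] -->
  pi ^+ 2 * (b - a) * euler_product R * \sum_(g <- squarefree_ball) alpha R g.
Proof.
rewrite mulr_sumr.
(* A perturbation with constant 0: the fibred formula for the count is available for X > 0 only, so
   the two functions are identified from X = 1 on. *)
apply: (@cvg_pinfty_perturb R (fun X => \sum_(g <- squarefree_ball)
   (\sum_(x <- region_fset a b (root4 (X / gabs g ^+ 2))) (carefree g x)%:R : R)
     / X) _ _ 0 1 1) => //; last first.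
  move=> X X1; rewrite carefree_count_sum ?(lt_le_trans ltr01 X1) //.
  by rewrite mulr_suml subrr normr0 mul0r.
rewrite big_seq; under eq_fun do rewrite big_seq.
apply: cvg_sumr => g; rewrite in_squarefree_ball => /set_mem[sg _].
have g2 : 0 < gabs g ^+ 2 by rewrite exprn_gt0 // gabs_gt0; case: sg.
have /(proj1 (@cvg_pinftyP R _ _)) h := carefree_density a0 ab sg.
apply (proj2 (@cvg_pinftyP R _ _)) => eps eps0.
have [M hM] := h _ (mulr_gt0 eps0 g2).
pose M1 := Num.max 1 M.
have M10 : 0 < M1 by rewrite lt_max ltr01.
(* Since T^4 = X / |g|^2, this threshold for X means T >= M1. *)
exists (gabs g ^+ 2 * M1 ^+ 4) => X XM.
have X0 : 0 < X by apply: lt_le_trans XM; rewrite mulr_gt0 // exprn_gt0.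
set T := root4 (X / gabs g ^+ 2).
have TX : T ^+ 4 = X / gabs g ^+ 2 by rewrite root4X // divr_ge0 ?ltW.
have MT : M <= T.
  apply: (@le_trans _ _ M1); first by rewrite le_max lexx orbT.
  rewrite -(@ler_pXn2r _ 4) ?nnegrE ?root4_ge0 ?(ltW M10) //.
  by rewrite TX ler_pdivlMr // mulrC.
have {hM} := hM T MT; rewrite TX; set C := \sum_(x <- _) _.
rewrite /alpha -/(prime_weight R _); set phi := \big[_/_]_(_ \in _) _ => hM.
have -> : C / X - pi ^+ 2 * (b - a) * euler_product R * ((gabs g ^+ 2)^-1 * phi) =
  (C / (X / gabs g ^+ 2) - pi ^+ 2 * (b - a) * (euler_product R * phi)) / gabs g ^+ 2.
  by move: (gabs g ^+ 2) g2 => N N0; field; rewrite !gt_eqF.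
by rewrite normrM normfV (gtr0_norm g2) ler_pdivrMr.
Qed.

End triples.

(** * The mass of the rectangle and the conclusion *)

Lemma mu_sf_itv (R : realType) (c d : R) : 0 < c ->
  mu_sf R `[c, d] = (\sum_(g <- squarefree_ball c d) alpha R g)%:E.
Proof.
move=> c0.
have fin : finite_set [set g | squarefree g /\ c <= gabs R g <= d].
  by apply: sub_finite_set (@finite_gabs_le R d) => x /= [_ /andP[]].
have -> : mu_sf R `[c, d] = (\esum_(g in [set g | squarefree g] `&`
    [set g | (c <= gabs R g <= d)%R]) (alpha R g)%:E)%E.
  rewrite esum_mkcondr; apply: eq_esum => g _; rewrite diracE.
  have -> : (gabs R g \in `[c, d]%classic) = (g \in [set g | c <= gabs R g <= d]).
    by apply/idP/idP => /set_mem gn; apply/mem_set; move: gn; rewrite /= in_itv.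
  by case: ifP => _; rewrite ?mule1 ?mule0.
rewrite esum_fset //; last by move=> g _; rewrite lee_fin alpha_ge0.
by rewrite fsbig_finite //= sumEFin.
Qed.

Lemma mu_infty_itv (R : realType) (a b : R) : 0 < a -> a <= b ->
  mu_infty R `[a, b] = (pi ^+ 2 * euler_product R * (b - a))%:E.
Proof.
move=> a0 ab; rewrite /mu_infty /mscale /= /mrestr.
have -> : `[a, b]%classic `&` `]0%R, +oo[%classic = `[a, b]%classic :> set R.
  apply/setIidPl => x; rewrite /= !in_itv /= andbT => /andP[ax _].
  exact: lt_le_trans ax.
rewrite lebesgue_measure_itv /= lte_fin.
case: ltP => [_|ba]; first by rewrite -EFinB -EFinM.
have -> : b = a by apply/eqP; rewrite eq_le ba ab.
by rewrite mule0 subrr mulr0.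
Qed.

Theorem theoremA (R : realType) (R1' R1 R2' R2 : R)
  (hR1' : 0 < R1') (hR1 : R1' <= R1) (hR2' : 0 < R2') (hR2 : R2' <= R2) :
  let rect : set (R * R) := `[R1', R1] `*` `[R2', R2] in
  ((carefree_count rect X)%:R / X)%:E @[X --> +oo%R] -->
    (\int[mu_hat R]_(z in rect) 1)%E.
Proof.
move=> rect.
have -> : (\int[mu_hat R]_(z in rect) 1 = mu_infty R `[R1', R1] * mu_sf R `[R2', R2])%E.
  transitivity (1 * mu_hat R rect)%E.
    by apply: integral_cst; apply: measurableX; exact: measurable_itv.
  rewrite mul1e; exact: (@product_measure1E _ _ (measurableTypeR R)
    (measurableTypeR R) R (mu_infty R) (mu_sf R)).
rewrite mu_infty_itv // mu_sf_itv // -EFinM.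
apply: cvg_EFin; first by apply: nearW.
have := @carefree_count_limit R R1' R1 R2' R2 hR1' hR1 hR2'.
by rewrite [_ * _ * euler_product R]mulrAC.
Qed.
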